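(* Let $d\ge 4$ be even. Then there exist two convex bodies of revolution $K_1,K_2\subset\mathbb{R}^d$ that are essentially different (i.e. not congruent: no isometry of $\mathbb{R}^d$ maps $K_1$ onto $K_2$) such that for all $u\in\mathbb{S}^{d-1}$ $$A_{K_1}(u)=A_{K_2}(u),\qquad M_{K_1}(u)=M_{K_2}(u),\qquad P_{K_1}(u)=P_{K_2}(u).$$
   Context: A convex body $K\subset\mathbb{R}^d$ is a compact convex subset of $\mathbb{R}^d$ with non-empty interior; it is assumed that $0\in K$. A body of revolution is a body invariant under all rotations about some fixed line (its axis). For $u\in\mathbb{S}^{d-1}$, $u^\perp$ is the hyperplane through the origin orthogonal to $u$, and $K|u^\perp$ is the orthogonal projection of $K$ to $u^\perp$. For $u\in\mathbb{S}^{d-1}$ define the central section function $A_K(u)=\mathrm{vol}_{d-1}(K\cap u^\perp)$, the maximal section function $M_K(u)=\max_{t\in\mathbb{R}}\mathrm{vol}_{d-1}(K\cap(u^\perp+tu))$, and the projection function $P_K(u)=\mathrm{vol}_{d-1}(K|u^\perp)$. *)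

(* Defs.v *)
From HB Require Import structures.
From mathcomp Require Import all_boot all_order all_algebra.
From mathcomp Require Import all_classical all_reals all_analysis.
From mathcomp Require Import ring.
Import Order.TTheory GRing.Theory Num.Theory.
Import numFieldNormedType.Exports.

Set Implicit Arguments.
Unset Strict Implicit.
Unset Printing Implicit Defensive.

Local Open Scope classical_set_scope.
Local Open Scope ring_scope.

Section LebesgueMeasure.
Variable R : realType.
Local Notation RT := (measurableTypeR R).
Local Notation lambda := (@lebesgue_measure R).

Definition cons_pair n (p : RT * n.-tuple RT) : n.+1.-tuple RT :=
  [tuple of p.1 :: p.2].

Lemma measurable_cons_pair n : measurable_fun setT (@cons_pair n).
Proof. exact: measurable_cons. Qed.

Section step.
Variables (n : nat) (mu : {measure set (n.-tuple RT) -> \bar R}).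

(* [\x^] rather than [\x]: only its left factor has to be sigma-finite. *)
Definition lebesgueS : set (n.+1.-tuple RT) -> \bar R :=
  pushforward (lambda \x^ mu)%E (@cons_pair n).

Let cons_measure : {measure set (n.+1.-tuple RT) -> \bar R} :=
  measure_function_pushforward__canonical__measure_function_Measure
    (lambda \x^ mu)%E (@measurable_cons_pair n).

Let lebesgueS0 : lebesgueS set0 = 0%E.
Proof. exact: (measure0 cons_measure). Qed.

Let lebesgueS_ge0 A : (0 <= lebesgueS A)%E.
Proof. exact: (measure_ge0 cons_measure). Qed.

Let lebesgueS_sigma_additive : semi_sigma_additive lebesgueS.
Proof. exact: (@measure_semi_sigma_additive _ _ _ cons_measure). Qed.

HB.instance Definition _ := isMeasure.Build _ _ _ lebesgueS
  lebesgueS0 lebesgueS_ge0 lebesgueS_sigma_additive.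
End step.

(* Lebesgue measure on the Borel sets of R^n. *)
Fixpoint lebesgueRn n : {measure set (n.-tuple RT) -> \bar R} :=
  match n with
  | 0 => @dirac _ (0.-tuple RT) [tuple] R
  | n'.+1 => lebesgueS (lebesgueRn n')
  end.

Lemma lebesgueRn_box n (A : 'I_n -> set RT) : (forall i, measurable (A i)) ->
  lebesgueRn n [set t | forall i, A i (tnth t i)] =
  (\prod_(i < n) lambda (A i))%E.
Proof.
elim: n A => [|n IH] A mA.
  rewrite big_ord0 /= diracE mem_set//=; by case.
rewrite big_ord_recl -IH; last by move=> i; exact: mA.
rewrite -[LHS]/((lambda \x^ lebesgueRn n)%E (@cons_pair n @^-1` _)).
rewrite -product_measure2E//; last first.
  rewrite [X in measurable X](_ : _ = \bigcap_(i in [set: 'I_n])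
      ((fun t => tnth t i) @^-1` A (lift ord0 i))).
    apply: fin_bigcap_measurable => [|i _]; first exact: finite_finset.
    rewrite -[X in measurable X]setTI.
    exact: (measurable_tnth i measurableT (mA _)).
  by apply/seteqP; split => t /= h i; [move=> _|]; exact: h.
congr (product_measure2 _ _ _); apply/seteqP; split => -[x t] /= h.
  split=> [|i]; first by have := h ord0; rewrite tnth0.
  by have := h (lift ord0 i); rewrite tnthS.
move=> i; case: h => h0 h1.
by case: (unliftP ord0 i) => [j|] ->; rewrite ?tnthS ?tnth0//; exact: h1.
Qed.

End LebesgueMeasure.

Section Geometry.
Variables (R : realType) (d : nat).
Implicit Types (x y u : 'rV[R]_d) (S K : set 'rV[R]_d) (t : R).

Definition dot x y : R := (x *m y^T) 0 0.

(* The library norm on 'rV[R]_d is the sup norm. *)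
Definition enorm x : R := Num.sqrt (dot x x).

Definition sphere : set 'rV[R]_d := [set u | enorm u = 1].

Definition perp u : set 'rV[R]_d := [set x | dot x u = 0].

Definition hyperplane u t : set 'rV[R]_d := [set y + t *: u | y in perp u].

Definition proj_perp u x : 'rV[R]_d := x - dot x u *: u.

(* The rows of B form an orthonormal basis of perp u. *)
Definition perp_basis u (B : 'M[R]_(d.-1, d)) : Prop :=
  B *m B^T = 1%:M /\ B *m u^T = 0.

Definition perp_frame u : 'M[R]_(d.-1, d) := xget 0 [set B | perp_basis u B].

(* (d-1)-dimensional volume of a subset of a translate of perp u. The map
   x |-> x *m (perp_frame u)^T is an isometry of each such translate onto
   R^(d-1), and lebesgueRn is invariant under isometries, so that for Borel S
   the value does not depend on the orthonormal basis. *)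
Definition hyperplane_vol u S : \bar R :=
  lebesgueRn R d.-1
    [set [tuple (x *m (perp_frame u)^T) 0 i | i < d.-1] | x in S].

Definition central_section K u : \bar R := hyperplane_vol u (K `&` perp u).

(* For compact K the supremum is attained: it is the maximum over t. *)
Definition maximal_section K u : \bar R :=
  ereal_sup [set hyperplane_vol u (K `&` hyperplane u t) | t in [set: R]].

Definition projection_vol K u : \bar R :=
  hyperplane_vol u (proj_perp u @` K).

Definition convex_body K : Prop :=
  [/\ compact K, convex_set K & K° !=set0].

(* Q, acting on row vectors, is the linear part of a rotation about the line
   p + R v; the line need not pass through the origin. *)
Definition body_of_revolution K : Prop :=
  exists p v : 'rV[R]_d, v != 0 /\
    forall Q : 'M[R]_d, Q *m Q^T = 1%:M -> \det Q = 1 -> v *m Q = v ->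
      [set p + (x - p) *m Q | x in K] = K.

Definition congruent K1 K2 : Prop :=
  exists f : 'rV[R]_d -> 'rV[R]_d,
    (forall x y, enorm (f x - f y) = enorm (x - y)) /\ f @` K1 = K2.

End Geometry.

Lemma perp_frameP (R : realType) (d : nat) (u : 'rV[R]_d) :
  sphere u -> perp_basis u (perp_frame u).
Proof.
rewrite /sphere /= /enorm => u1.
have {u1} uu : dot u u = 1.
  have u0 : 0 <= dot u u.
    by rewrite /dot mxE sumr_ge0// => i _; rewrite mxE -expr2 sqr_ge0.
  by rewrite -(sqr_sqrtr u0) u1 expr1n.
apply: xgetPex.
case: d u uu => [|n] u uu.
  by move: uu; rewrite /dot mxE big_ord0 => /esym/eqP; rewrite oner_eq0.
(* rows of the Householder reflection swapping e0 and u *)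
suff [H HH H0] : exists2 H : 'M[R]_n.+1, H *m H^T = 1%:M & row 0 H = u.
  exists (row' 0 H); split; apply/matrixP => i j; rewrite !mxE.
    have /matrixP/(_ (lift 0 i) (lift 0 j)) := HH.
    rewrite !mxE (inj_eq (@lift_inj _ _)) => <-.
    by apply: eq_bigr => k _; rewrite !mxE.
  have /matrixP/(_ (lift 0 i) 0) := HH.
  rewrite !mxE /= => H1; rewrite -[RHS]H1.
  by apply: eq_bigr => k _; rewrite -H0 !mxE.
pose e : 'rV[R]_n.+1 := delta_mx 0 0.
have uuM : u *m u^T = 1%:M by rewrite [LHS]mx11_scalar -/(dot u u) uu.
have eeM : e *m e^T = 1%:M.
  by rewrite /e trmx_delta mul_delta_mx [LHS]mx11_scalar mxE eqxx.
have [ue|ue] := eqVneq u e.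
  exists 1%:M; first by rewrite trmx1 mulmx1.
  by rewrite ue /e row1.
pose w := u - e; pose c := dot u e.
have ueM : u *m e^T = c%:M by rewrite [LHS]mx11_scalar.
have euM : e *m u^T = c%:M by rewrite -[LHS]trmxK trmx_mul trmxK ueM tr_scalar_mx.
have wwM : w *m w^T = (2 - 2 * c)%:M.
  rewrite /w linearB /= mulmxBl !mulmxBr uuM eeM ueM euM -!raddfB /=.
  by congr (_%:M); ring.
have c1 : 1 - c != 0.
  apply: contra ue => /eqP c1; rewrite -subr_eq0 -/w; apply/eqP/rowP => i.
  have : dot w w = 0.
    by rewrite /dot wwM mxE eqxx mulr1n -{1}(mulr1 2) -mulrBr c1 mulr0.
  rewrite /dot mxE => /psumr_eq0P H.
  have wj j : true -> 0 <= w 0 j * w^T j 0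
    by rewrite [w^T _ _]mxE -expr2 sqr_ge0.
  have /eqP := H wj i isT.
  by rewrite [w^T _ _]mxE mulf_eq0 orbb [RHS]mxE => /eqP.
pose W := w^T *m w.
have WT : W^T = W by rewrite trmx_mul trmxK.
have WW : W *m W = (2 - 2 * c) *: W.
  by rewrite /W mulmxA -(mulmxA _ w) wwM mul_mx_scalar -scalemxAl.
exists (1%:M - (1 - c)^-1 *: W).
  have -> : (1%:M - (1 - c)^-1 *: W)^T = 1%:M - (1 - c)^-1 *: W.
    by apply/matrixP => i j; rewrite -{1}WT !mxE eq_sym.
  rewrite mulmxBl mul1mx mulmxBr mulmx1 -scalemxAl -scalemxAr WW.
  by apply/matrixP => i j; rewrite !mxE; field; exact: c1.
rewrite rowE mulmxBr mulmx1 -scalemxAr mulmxA -/e.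
have -> : e *m w^T = (c - 1)%:M.
  by rewrite /w [(u - e)^T]linearB mulmxBr euM eeM -raddfB.
rewrite mul_scalar_mx scalerA -(opprB 1 c) mulrN mulVf// scaleN1r opprK.
by rewrite /w addrC subrK.
Qed.

(* Main.v *)
Require Import Defs.
From HB Require Import structures.
From mathcomp Require Import all_boot all_order all_algebra.
From mathcomp Require Import all_classical all_reals all_analysis.
From mathcomp Require Import measurable_realfun.
From mathcomp Require Import ring lra zify.

Import Order.TTheory GRing.Theory Num.Theory.
Import numFieldNormedType.Exports.

(** Let d = 2 q + 2. Both bodies are balls of radius N with low ridges. Cut the
axis into unit cells [j, j + 1); a set X of cells determines the ridged ball
of all x with |x|^2 <= N^2 + ridge X x_0, where ridge X is, over a cell of X,
the squared distance to the nearest end of the cell, and 0 elsewhere. Since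
ridge X xi is the minimum of (xi - p)^2 over the latitudes p that are not
interior to a cell of X, a ridged ball is an intersection of the solid
paraboloids |x|^2 <= N^2 + (x_0 - p)^2; so it is convex
([convex_body_body]).

The two patterns share a set of middle cells in [- W, W); one of them has in
addition a cell a beyond the middle cells, the other one the mirror cell
- a - 1 instead.

Central sections and shadows. The reflection x -> - x exchanges the two outer
cells. Hence a central section of one body becomes one of the other if its
part over the outer cells is reflected ([vol_central_flip]). The same surgery
works for shadows ([vol_shadow_flip]), since a point of a shadow that is
farther than N from the origin is the image of a point in the ridge over its
own cell ([shadow_local]).

Maximal sections. Every section of one body is at most some parallel section
of the other ([section_le]). A hyperplane at distance at least 1/2 from the
origin does worse than the central one. A hyperplane close to the origin that
is nearly perpendicular to the axis misses the outer ridges, so it cuts both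
bodies in the same set ([flat_section]). A steeper hyperplane at distance t
crosses all the middle cells. Its section is foliated by balls of dimension
2 q, whose volumes are polynomials in the squared radius; here the parity of
d is used. Thus the ridge over the cell j increases the volume of the section
by the integral of a polynomial of degree at most 2 q in j. The middle cells
are placed according to the signs of the Thue-Morse sequence, so by the
Prouhet identity ([prouhet]) the volume does not change if the middle cells
are replaced by the complementary ones ([vol_sect_thue_morse]). The
complementary ones are the mirror images, hence the section of one body at t
has the volume of the section of the other body at - t
([vol_steep_section]).

The bodies are not congruent: an isometry between ridged balls fixes the
origin, hence maps the crests of the ridges to crests, hence preserves the
axis; so one pattern is contained in the other one or in its mirror image
([congruent_bodies]), which is not the case.

The volumes are computed in arbitrary orthonormal frames of the hyperplanes;
the invariance of Lebesgue measure under orthogonal maps comes from the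
uniqueness of Haar measure ([vol_linear_ratio]). *)

Set Implicit Arguments.
Unset Strict Implicit.
Unset Printing Implicit Defensive.

Local Open Scope classical_set_scope.
Local Open Scope ring_scope.

(** * The scalar product *)

Section Dot.
Variable R : realType.
Implicit Types n m : nat.

Lemma dot_sum n (x y : 'rV[R]_n) : dot x y = \sum_i x 0 i * y 0 i.
Proof. by rewrite /dot mxE; apply: eq_bigr => i _; rewrite mxE. Qed.

Lemma dotC n (x y : 'rV[R]_n) : dot x y = dot y x.
Proof. by rewrite !dot_sum; apply: eq_bigr => i _; rewrite mulrC. Qed.

Lemma dotDl n (x y z : 'rV[R]_n) : dot (x + y) z = dot x z + dot y z.
Proof. by rewrite /dot mulmxDl mxE. Qed.

Lemma dotZl n a (x z : 'rV[R]_n) : dot (a *: x) z = a * dot x z.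
Proof. by rewrite /dot -scalemxAl mxE. Qed.

Lemma dotDr n (x y z : 'rV[R]_n) : dot z (x + y) = dot z x + dot z y.
Proof. by rewrite !(dotC z) dotDl. Qed.

Lemma dotZr n a (x z : 'rV[R]_n) : dot z (a *: x) = a * dot z x.
Proof. by rewrite !(dotC z) dotZl. Qed.

Lemma dotNl n (x z : 'rV[R]_n) : dot (- x) z = - dot x z.
Proof. by rewrite -scaleN1r dotZl mulN1r. Qed.

Lemma dotNr n (x z : 'rV[R]_n) : dot z (- x) = - dot z x.
Proof. by rewrite !(dotC z) dotNl. Qed.

Lemma dot0l n (z : 'rV[R]_n) : dot 0 z = 0.
Proof. by rewrite /dot mul0mx mxE. Qed.

Lemma dotM n m (x : 'rV[R]_n) (y : 'rV[R]_m) (M : 'M[R]_(n, m)) :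
  dot (x *m M) y = dot x (y *m M^T).
Proof. by rewrite /dot trmx_mul trmxK mulmxA. Qed.

Lemma dot_ge0 n (x : 'rV[R]_n) : 0 <= dot x x.
Proof. by rewrite dot_sum sumr_ge0// => i _; rewrite -expr2 sqr_ge0. Qed.

Lemma coord_dot n (x : 'rV[R]_n) i : x 0 i ^+ 2 <= dot x x.
Proof.
by rewrite dot_sum (bigD1 i)//= -expr2 lerDl sumr_ge0// => j _;
  rewrite -expr2 sqr_ge0.
Qed.

Lemma dot_delta n (x : 'rV[R]_n) i : dot x (delta_mx 0 i) = x 0 i.
Proof.
rewrite dot_sum (bigD1 i)//= mxE !eqxx mulr1 big1 ?addr0// => j ji.
by rewrite mxE (negPf ji) andbF mulr0.
Qed.

Lemma coord2_dot n (x : 'rV[R]_n) i j : i != j ->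
  x 0 i ^+ 2 + x 0 j ^+ 2 <= dot x x.
Proof.
move=> ij; rewrite dot_sum (bigD1 i)//= -expr2 lerD2l (bigD1 j) 1?eq_sym//=.
by rewrite -expr2 lerDl sumr_ge0// => k _; rewrite -expr2 sqr_ge0.
Qed.

Lemma dotBB n (a b : 'rV[R]_n) :
  dot (a - b) (a - b) = dot a a - 2 * dot a b + dot b b.
Proof. by rewrite !(dotDl, dotDr, dotNl, dotNr) (dotC b a); ring. Qed.

End Dot.

(** * Lebesgue measure on row vectors *)

Section Volume.
Variable R : realType.
Local Notation RT := (measurableTypeR R).
Local Notation lambda := (@lebesgue_measure R).
Implicit Types n : nat.

Definition row_of n (t : n.-tuple RT) : 'rV[R]_n := \row_i tnth t i.

(** [lebesgueRn] is a fixpoint with values in bundled measures; this constant is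
the head symbol that carries sigma-finiteness. *)
Definition leb n : set (n.-tuple RT) -> \bar R := lebesgueRn R n.

HB.instance Definition _ n := Measure.on (@leb n).

Lemma leb_sigma_finite n : sigma_finite setT (@leb n).
Proof.
pose I (k : nat) : set R := `]- k%:R, k%:R[%classic.
exists (fun k => [set t : n.-tuple RT | forall i, I k (tnth t i)]).
  apply/esym; rewrite -subTset => t _.
  have [k kP] : exists k : nat, forall i : 'I_n, `|tnth t i| < k%:R.
    exists (Num.truncn (\sum_(i < n) `|tnth t i|)).+1 => i.
    apply: le_lt_trans (truncnS_gt _).
    by rewrite (bigD1 i)//= lerDl sumr_ge0.
  by exists k => //= i; rewrite /I /= in_itv/= -ltr_norml.
move=> k; split.
  rewrite [X in measurable X](_ : _ = \bigcap_(i in [set: 'I_n])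
      ((fun t : n.-tuple RT => tnth t i) @^-1` I k)).
    apply: fin_bigcap_measurable => [|i _]; first exact: finite_finset.
    rewrite -[X in measurable X]setTI.
    by apply: measurable_tnth => //; exact: measurable_itv.
  by apply/seteqP; split => t /= h i; [move=> _|]; exact: h.
rewrite -[leb _]/(lebesgueRn R n _) (@lebesgueRn_box R n (fun=> I k)); last first.
  by move=> i; exact: measurable_itv.
rewrite ltey_eq; apply/orP; left.
elim/big_ind : _ => // [x y|i _]; first exact: fin_numM.
by rewrite lebesgue_measure_itv/=; case: ifP.
Qed.

HB.instance Definition _ n :=
  Measure_isSigmaFinite.Build _ _ _ (@leb n) (@leb_sigma_finite n).

(** Volume is transported from tuples, which carry the sigma-algebra, to row
vectors, which carry the linear algebra and the topology. *)
Definition vol n (S : set 'rV[R]_n) : \bar R := leb (@row_of n @^-1` S).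

Definition borel n (S : set 'rV[R]_n) : Prop := measurable (@row_of n @^-1` S).

Lemma borel_preimage d (T : measurableType d) n (f : T -> 'rV[R]_n)
    (S : set 'rV[R]_n) :
  (forall i, measurable_fun setT (fun t => f t 0 i : RT)) -> borel S ->
  measurable (f @^-1` S).
Proof.
move=> mf mS.
pose g t : n.-tuple RT := [tuple f t 0 i | i < n].
have mg : measurable_fun setT g.
  apply/measurable_fun_tnthP => i.
  rewrite (_ : _ \o _ = fun t => f t 0 i : RT)//.
  by apply/funext => t /=; rewrite tnth_mktuple.
have -> : f = @row_of n \o g.
  by apply/funext => t /=; apply/rowP => i; rewrite mxE tnth_mktuple.
by rewrite -[X in measurable X]setTI comp_preimage; exact: (mg measurableT _ mS).
Qed.

Lemma measurable_mulmx d (T : measurableType d) m n (f : T -> 'rV[R]_m)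
    (M : 'M[R]_(m, n)) j :
  (forall i, measurable_fun setT (fun t => f t 0 i : RT)) ->
  measurable_fun setT (fun t => (f t *m M) 0 j : RT).
Proof.
move=> mf; under eq_fun do rewrite mxE.
apply: measurable_sum => i.
apply: measurable_funM; first exact: mf.
exact: measurable_cst.
Qed.

Lemma measurable_row_of n i :
  measurable_fun setT (fun t : n.-tuple RT => row_of t 0 i : RT).
Proof.
under eq_fun do rewrite mxE.
exact: measurable_tnth.
Qed.

Lemma borel_affine m n (S : set 'rV[R]_n) (M : 'M[R]_(m, n)) (v : 'rV[R]_n) :
  borel S -> borel [set x | S (x *m M + v)].
Proof.
move=> mS; rewrite /borel; apply: (borel_preimage _ mS) => i.
under eq_fun do rewrite mxE.
apply: measurable_funD => //.
by apply: measurable_mulmx => j; exact: measurable_row_of.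
Qed.

Lemma lebesgue_measureD (a : R) (A : set RT) : measurable A ->
  lambda [set x : RT | A (x + a)] = lambda A.
Proof.
move=> mA.
have mf : measurable_fun setT (fun x : RT => x + a : RT).
  by apply: measurable_funD => //; exact: measurable_cst.
rewrite -[LHS]/(pushforward lambda (fun x : RT => x + a : RT) A).
apply/esym/lebesgue_measure_unique => //= _ [[b c]] _ <-.
rewrite /pushforward/=.
rewrite [X in _ = lambda X](_ : _ = `]b - a, c - a]%classic); last first.
  by apply/seteqP; split => x /=; rewrite !in_itv/= ltrBlDr lerBrDr.
by rewrite !lebesgue_measure_itv/= !lte_fin ltrD2r !EFinB; case: ifP => // _;
  rewrite -!EFinB; congr (_%:E); ring.
Qed.

Definition tadd n (v t : n.-tuple RT) : n.-tuple RT :=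
  [tuple tnth t i + tnth v i | i < n].

Lemma measurable_tadd n (v : n.-tuple RT) : measurable_fun setT (tadd v).
Proof.
apply/measurable_fun_tnthP => i.
rewrite (_ : _ \o _ = fun t => tnth t i + tnth v i : RT)//.
  by apply: measurable_funD; [exact: measurable_tnth|exact: measurable_cst].
by apply/funext => t /=; rewrite tnth_mktuple.
Qed.

Lemma leb_tadd n (v : n.-tuple RT) (A : set (n.-tuple RT)) :
  measurable A -> leb (tadd v @^-1` A) = leb A.
Proof.
elim: n v A => [|n IH] v A mA.
  rewrite (_ : tadd v @^-1` A = A)//; apply: eq_set => t.
  by congr A; rewrite [RHS]tuple0; exact: tuple0.
have mf := @measurable_cons_pair R n.
pose F (y : n.-tuple RT) := lambda (ysection (@cons_pair R n @^-1` A) y).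
have mcA : measurable (@cons_pair R n @^-1` A).
  by rewrite -[X in measurable X]setTI; exact: mf.
have mF : measurable_fun setT F by exact: measurable_fun_ysection.
pose w : n.-tuple RT := [tuple of behead v].
have taddE x y : tadd v (cons_pair (x, y)) = cons_pair (x + thead v, tadd w y).
  apply: eq_from_tnth => i; rewrite tnth_mktuple /cons_pair/=.
  case: (unliftP ord0 i) => [j|] ->; last by rewrite !tnth0.
  rewrite !tnthS tnth_mktuple; congr (_ + _).
  by rewrite [in LHS](tuple_eta v) tnthS.
transitivity (\int[@leb n]_y F (tadd w y))%E.
  apply: eq_integral => y _ /=.
  rewrite -[RHS](@lebesgue_measureD (thead v)
    (ysection (@cons_pair R n @^-1` A) (tadd w y))); last first.
    exact: measurable_ysection.
  rewrite /ysection; congr (lambda _); apply/seteqP; split => x /=;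
    by rewrite !inE /preimage /= taddE.
rewrite -[RHS]/(\int[@leb n]_y F y)%E.
rewrite -(ge0_integral_pushforward (measurable_tadd w)
  (f := F) (@leb n) measurableT) //.
apply: (eq_measure_integral (@leb n)); first exact: measurable_tadd.
by move=> mT B mB _; exact: IH.
Qed.

Lemma fubini_leb n (E : set (n.-tuple RT * n.-tuple RT)) : measurable E ->
  (\int[@leb n]_x leb (xsection E x) = \int[@leb n]_y leb (ysection E y))%E.
Proof.
move=> mE; apply: (product_measure_unique (m' := (@leb n \x^ @leb n)%E)) => //.
by move=> A B mA mB; rewrite /= product_measure2E.
Qed.

Lemma vol_translate n (S : set 'rV[R]_n) (v : 'rV[R]_n) : borel S ->
  vol [set x | S (x + v)] = vol S.
Proof.
move=> mS; rewrite /vol -[RHS](leb_tadd [tuple v 0 i | i < n])//.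
congr (leb _); apply: eq_set => t; rewrite /preimage /=; congr S.
by apply/rowP => i; rewrite !mxE !tnth_mktuple.
Qed.

Lemma integral_section n (P : set 'rV[R]_n) (f : n.-tuple RT -> \bar R) c :
  borel P -> (0 <= c)%E ->
  (forall x, P (row_of x) -> f x = c) -> (forall x, ~ P (row_of x) -> f x = 0)%E ->
  (\int[@leb n]_x f x = vol P * c)%E.
Proof.
move=> mP c0 fP fN.
transitivity (\int[@leb n]_x (c * (\1_(@row_of n @^-1` P) x)%:E))%E.
  apply: eq_integral => x _; rewrite indicE.
  have [xP|xP] := boolP (x \in _).
    by rewrite mule1 fP//; move: xP; rewrite inE.
  by rewrite mule0 fN//; move: xP; rewrite notin_setE.
rewrite ge0_integralZl//; last by apply/measurable_EFinP; exact: measurable_indic.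
by rewrite integral_indic// setIT muleC.
Qed.

(** Uniqueness of Haar measure as an equality of ratios. Both sides measure the
pairs (x, w) with x in A and x + w M in B. For fixed x, the fibre is a
translate of the preimage of B under M. For fixed w, translate the fibre by
w M; the result is a fibre of the pairs with x in B and x - w M in A, and for
fixed x these form a translate of the preimage of - A. *)
Lemma vol_linear_ratio n (M : 'M[R]_n) (A B : set 'rV[R]_n) : M \in unitmx ->
  borel A -> borel B ->
  (vol A * vol [set x | B (x *m M)] = vol B * vol [set x | A (- (x *m M))%R])%E.
Proof.
move=> uM mA mB.
have mrow1 i : measurable_fun setT
    (fun z : n.-tuple RT * n.-tuple RT => row_of z.1 0 i : RT).
  exact: (measurableT_comp (measurable_row_of i)).
have mrow2 i : measurable_fun setT
    (fun z : n.-tuple RT * n.-tuple RT => row_of z.2 0 i : RT).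
  exact: (measurableT_comp (measurable_row_of i)).
have mE c (S : set 'rV[R]_n) : borel S -> measurable
    [set z : n.-tuple RT * n.-tuple RT |
      S (row_of z.1 + c *: (row_of z.2 *m M))].
  move=> mS; apply: (borel_preimage _ mS) => i.
  rewrite (_ : (fun _ => _) = fun z : n.-tuple RT * n.-tuple RT =>
    row_of z.1 0 i + c * (row_of z.2 *m M) 0 i : RT); last first.
    by apply/funext => z; rewrite [LHS]mxE [X in _ + X]mxE.
  apply: measurable_funD; first exact: mrow1.
  apply: measurable_funM; first exact: measurable_cst.
  exact: measurable_mulmx.
have mE0 (S : set 'rV[R]_n) : borel S ->
    measurable [set z : n.-tuple RT * n.-tuple RT | S (row_of z.1)].
  by move=> mS; apply: (borel_preimage _ mS) => i.
pose E1 := [set z : n.-tuple RT * n.-tuple RT |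
  A (row_of z.1) /\ B (row_of z.1 + 1 *: (row_of z.2 *m M))].
pose E2 := [set z : n.-tuple RT * n.-tuple RT |
  B (row_of z.1) /\ A (row_of z.1 + -1 *: (row_of z.2 *m M))].
have mE1 : measurable E1 by apply: measurableI; [exact: mE0|exact: mE].
have mE2 : measurable E2 by apply: measurableI; [exact: mE0|exact: mE].
transitivity (\int[@leb n]_x leb (xsection E1 x))%E.
  apply/esym/integral_section => // x Ax.
    rewrite -(vol_translate (row_of x *m invmx M)).
      congr (leb _); rewrite /xsection; apply: eq_set => w; rewrite inE.
      rewrite /preimage /E1 /= mulmxDl mulmxKV// scale1r addrC.
      by apply/propeqP; split => [[]|].
    by have := borel_affine M 0 mB; under eq_set do rewrite addr0.
  rewrite (_ : xsection _ _ = set0) ?measure0//.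
  by rewrite /xsection -subset0 => w /=; rewrite inE /E1 /= => -[].
rewrite fubini_leb//.
transitivity (\int[@leb n]_x leb (xsection E2 x))%E; last first.
  apply/integral_section => // x Bx.
    rewrite -(vol_translate (- (row_of x *m invmx M))).
      congr (leb _); rewrite /xsection; apply: eq_set => w; rewrite inE.
      rewrite /preimage /E2 /= mulmxBl mulmxKV// scaleN1r opprB.
      by apply/propeqP; split => [[]|].
    have := borel_affine (- M) 0 mA.
    by under eq_set do rewrite addr0 mulmxN.
  rewrite (_ : xsection _ _ = set0) ?measure0//.
  by rewrite /xsection -subset0 => w /=; rewrite inE /E2 /= => -[].
rewrite fubini_leb//; apply: eq_integral => y _.
have -> : leb (ysection E2 y) =
    vol [set x | B x /\ A (x + -1 *: (row_of y *m M))].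
  by congr leb; rewrite /ysection; apply: eq_set => w; rewrite inE.
rewrite -(vol_translate (row_of y *m M)).
  congr (leb _); rewrite /ysection; apply: eq_set => w; rewrite inE.
  rewrite /preimage /E1 /= scale1r scaleN1r addrK.
  by apply/propeqP; split => [[]|[]].
apply: measurableI => //.
have := borel_affine 1%:M (-1 *: (row_of y *m M)) mA.
by under eq_set do rewrite mulmx1.
Qed.

Lemma borel_box n (a b : R) : borel [set x : 'rV[R]_n | forall i, a <= x 0 i <= b].
Proof.
rewrite /borel [X in measurable X](_ : _ = \bigcap_(i in [set: 'I_n])
      ((fun t : n.-tuple RT => tnth t i) @^-1` `[a, b]%classic)).
  apply: fin_bigcap_measurable => [|i _]; first exact: finite_finset.
  rewrite -[X in measurable X]setTI.
  by apply: measurable_tnth => //; exact: measurable_itv.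
apply/seteqP; split => t /= h i; first by move=> _; have := h i; rewrite mxE /= in_itv.
by have := h i I; rewrite mxE /= in_itv.
Qed.

Lemma vol_box n (a b : R) : a <= b ->
  vol [set x : 'rV[R]_n | forall i, a <= x 0 i <= b] = ((b - a) ^+ n)%:E.
Proof.
move=> ab; rewrite /vol.
rewrite (_ : _ @^-1` _ =
    [set t : n.-tuple RT | forall i, `[a, b]%classic (tnth t i)]); last first.
  apply/seteqP; split => t /= h i; have := h i; by rewrite mxE in_itv.
rewrite -[leb _]/(lebesgueRn R n _) (@lebesgueRn_box R n (fun=> `[a, b]%classic)).
  have -> : lambda `[a, b]%classic = (b - a)%:E.
    rewrite lebesgue_measure_itv/= lte_fin EFinB; case: ltP => // ba.
    have -> : a = b by apply/le_anti; rewrite ab ba.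
    by rewrite subee.
  by rewrite prodEFin prodr_const card_ord.
by move=> i; exact: measurable_itv.
Qed.

(** The parameter is the square of the radius. *)
Definition eball n (r : R) : set 'rV[R]_n := [set x | dot x x <= r].
Arguments eball : clear implicits.

Lemma measurable_dot d (T : measurableType d) n (f g : T -> 'rV[R]_n) :
  (forall i, measurable_fun setT (fun t => f t 0 i : RT)) ->
  (forall i, measurable_fun setT (fun t => g t 0 i : RT)) ->
  measurable_fun setT (fun t => dot (f t) (g t) : RT).
Proof.
move=> mf mg; under eq_fun do rewrite dot_sum.
by apply: measurable_sum => i; apply: measurable_funM; [exact: mf|exact: mg].
Qed.

Lemma borel_eball n r : borel (eball n r).
Proof.
rewrite /borel (_ : _ @^-1` _ = (fun t : n.-tuple RT =>
  dot (row_of t) (row_of t) : RT) @^-1` `]-oo, r]%classic).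
  rewrite -[X in measurable X]setTI.
  have mf := measurable_dot (@measurable_row_of n) (@measurable_row_of n).
  exact: (mf measurableT _ (measurable_itv _)).
by apply: eq_set => t; rewrite /preimage /eball /= in_itv.
Qed.

Lemma vol_le n (A B : set 'rV[R]_n) : borel A -> borel B -> A `<=` B ->
  (vol A <= vol B)%E.
Proof. by move=> mA mB AB; apply: le_measure; rewrite ?inE// => t; exact: AB. Qed.

Lemma vol_unit_ball n : exists2 c : R, 0 < c & vol (eball n 1) = c%:E.
Proof.
have le1 : (vol (eball n 1) <= (2 ^+ n)%:E)%E.
  rewrite (_ : 2 = 1 - -1); last by ring.
  rewrite -vol_box; last by lra.
  apply: vol_le; [exact: borel_eball|exact: borel_box|].
  move=> x xB i; have x1 := le_trans (coord_dot x i) xB.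
  by apply/andP; split; nra.
have le2 : (((n.+1%:R^-1) ^+ n : R)%:E <= vol (eball n 1))%E.
  rewrite -[n.+1%:R^-1]subr0 -vol_box ?invr_ge0//.
  apply: vol_le; [exact: borel_box|exact: borel_eball|].
  move=> x xB; rewrite /eball /= dot_sum.
  have hx : forall i : 'I_n, true -> x 0 i * x 0 i <= n.+1%:R^-1.
    move=> i _; have /andP[x0 x1] := xB i.
    have : n.+1%:R^-1 <= 1 :> R by rewrite invf_le1// ler1n.
    by move=> /(le_trans x1) h; rewrite (le_trans _ x1)// ler_piMr.
  apply: (@le_trans _ _ (\sum_(i < n) n.+1%:R^-1)).
    by apply: ler_sum => i _; exact: hx.
  rewrite sumr_const card_ord -[_ *+ n]mulr_natl.
  by rewrite ler_pdivrMr// mul1r ler_nat.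
have fin : vol (eball n 1) \is a fin_num.
  by rewrite ge0_fin_numE ?measure_ge0// (le_lt_trans le1)// ltry.
exists (fine (vol (eball n 1))); last by rewrite fineK.
rewrite -lte_fin fineK//; apply: lt_le_trans le2.
by rewrite lte_fin exprn_gt0// invr_gt0.
Qed.

(** The case M = 1 of [vol_linear_ratio], with a unit box for B. *)
Lemma vol_opp n (A : set 'rV[R]_n) : borel A ->
  vol [set x | A (- x)] = vol A.
Proof.
move=> mA; have := vol_linear_ratio (unitmx1 _ _) mA (@borel_box n 0 1).
have E (S : set 'rV[R]_n) : [set x | S (x *m 1%:M)] = S.
  by apply/seteqP; split => x /=; rewrite mulmx1.
rewrite (E [set x : 'rV[R]_n | forall i, 0 <= x 0 i <= 1]) (E [set x | A (- x)]).
by rewrite vol_box// subr0 expr1n mule1 mul1e => ->.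
Qed.

Lemma vol_linear_swap n (M : 'M[R]_n) (A B : set 'rV[R]_n) : M \in unitmx ->
  borel A -> borel B ->
  (vol A * vol [set x | B (x *m M)] = vol B * vol [set x | A (x *m M)])%E.
Proof.
move=> uM mA mB; rewrite vol_linear_ratio//; congr (_ * _)%E.
rewrite -[RHS]vol_opp; last by have := borel_affine M 0 mA; under eq_set do rewrite addr0.
by congr vol; apply: eq_set => x; rewrite /= mulNmx.
Qed.

(** The ratio is 1 because the unit ball is invariant. *)
Lemma vol_orthogonal n (Q : 'M[R]_n) (A : set 'rV[R]_n) : Q *m Q^T = 1%:M ->
  borel A -> vol [set x | A (x *m Q)] = vol A.
Proof.
move=> QQ mA.
have uQ : Q \in unitmx by case: (mulmx1_unit QQ).
have := vol_linear_swap uQ mA (@borel_eball n 1).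
rewrite (_ : [set x | eball n 1 _] = eball n 1); last first.
  by apply: eq_set => x; rewrite /eball /= /dot trmx_mul mulmxA -(mulmxA x) QQ mulmx1.
case: (vol_unit_ball n) => c c0 ->.
rewrite [LHS]muleC => h; apply/le_anti.
by apply/andP; split; rewrite -(@lee_pmul2l _ c%:E) ?lte_fin// h.
Qed.

(** The ratio of a homothety is read off the unit box. *)
Lemma vol_eball n (r : R) : 0 < r ->
  vol (eball n (r ^+ 2)) = ((r ^+ n)%:E * vol (eball n 1))%E.
Proof.
move=> r0.
have uM : (r^-1%:M : 'M[R]_n) \in unitmx.
  by rewrite unitmxE det_scalar unitrX// unitfE invr_neq0// gt_eqF.
have := vol_linear_swap uM (@borel_eball n 1) (@borel_box n 0 1).
rewrite vol_box// subr0 expr1n mul1e.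
rewrite (_ : [set x | [set y : 'rV[R]_n | forall i, 0 <= y 0 i <= 1] _] =
  [set x : 'rV[R]_n | forall i, 0 <= x 0 i <= r]); last first.
  apply/seteqP; split => x /= h i; have := h i; rewrite mul_mx_scalar mxE.
    by rewrite mulrC pmulr_lge0 ?invr_gt0// ler_pdivrMr// mul1r.
  by rewrite mulrC pmulr_lge0 ?invr_gt0// ler_pdivrMr// mul1r.
rewrite vol_box ?ltW// subr0 muleC => ->; congr vol; apply: eq_set => x.
rewrite /eball /= mul_mx_scalar dotZl dotZr mulrA -invfM -expr2 mulrC.
by rewrite ler_pdivrMr ?mul1r// exprn_gt0.
Qed.

(** An open set is the union of the rational boxes that it contains. *)
Lemma open_borel n (S : set 'rV[R]_n) : open S -> borel S.
Proof.
move=> oS.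
pose box (p : n.-tuple rat * nat) : set 'rV[R]_n :=
  [set x | forall i, - p.2.+1%:R^-1 <=
    (x *m 1%:M - \row_i ratr (tnth p.1 i)) 0 i <= p.2.+1%:R^-1].
pose F k := if unpickle k is Some p then
  if `[< box p `<=` S >] then box p else set0 else set0.
have -> : S = \bigcup_k F k.
  apply/seteqP; split => [x Sx|x [k _]]; last first.
    by rewrite /F; case: unpickle => //= p; case: asboolP => // pS /pS.
  have /nbhs_ballP[e /= e0 eS] : nbhs x S by exact: open_nbhs_nbhs.
  pose m := Num.truncn (2 / e).
  have me : m.+1%:R^-1 < e / 2.
    have h : 2 / e < m.+1%:R by rewrite truncnS_gt.
    have := h; rewrite -ltf_pV2 ?posrE ?divr_gt0//.
    by rewrite invf_div.
  have /choice[q qP] (i : 'I_n) : exists q : rat, `|x 0 i - ratr q| <= m.+1%:R^-1.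
    have /rat_in_itvoo[q] : x 0 i - m.+1%:R^-1 < x 0 i + m.+1%:R^-1.
      by rewrite ltrBlDr -addrA ltrDl addr_gt0 ?invr_gt0//.
    rewrite in_itv/= => /andP[h1 h2]; exists q; rewrite ler_norml.
    by move: (m.+1%:R^-1) h1 h2 => k h1 h2; apply/andP; split; lra.
  exists (pickle ([tuple q i | i < n], m)) => //.
  rewrite /F pickleK.
  case: asboolP => [_ i|[]].
    by rewrite mulmx1 /= !mxE tnth_mktuple -ler_norml.
  move=> y yb; apply: eS; split => // i j; rewrite (ord1 i).
  have := yb j; rewrite mulmx1 /= !mxE tnth_mktuple -ler_norml => h.
  rewrite /ball /= (le_lt_trans (ler_distD (ratr (q j)) _ _))//.
  have := qP j; rewrite [`|ratr _ - _|]distrC; move: (m.+1%:R^-1) me h => k; lra.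
rewrite /borel preimage_bigcup; apply: bigcup_measurable => k _.
rewrite /F; case: unpickle => [p|]; last by rewrite preimage_set0.
case: asboolP => // _; last by rewrite preimage_set0.
exact: (borel_affine 1%:M (- \row_i ratr (tnth p.1 i))
  (@borel_box n (- p.2.+1%:R^-1) p.2.+1%:R^-1)).
Qed.

Lemma closed_borel n (S : set 'rV[R]_n) : closed S -> borel S.
Proof.
move=> cS; have := open_borel (closed_openC cS).
by rewrite /borel preimage_setC => /measurableC; rewrite setCK.
Qed.

Definition vcons m (x : R) (y : 'rV[R]_m) : 'rV[R]_m.+1 :=
  row_mx x%:M y : 'rV_(1 + m).

Lemma dot_vcons m x (y : 'rV[R]_m) : dot (vcons x y) (vcons x y) = x ^+ 2 + dot y y.
Proof.
rewrite -[LHS]/(@dot R (1 + m) (row_mx x%:M y) (row_mx x%:M y)).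
rewrite /dot tr_row_mx mul_row_col mxE tr_scalar_mx -scalar_mxM.
by rewrite mxE eqxx mulr1n -expr2.
Qed.

Lemma vcons0 m x (y : 'rV[R]_m) : vcons x y 0 0 = x.
Proof.
have := @row_mxEl R 1 1 m x%:M y 0 0; rewrite [RHS]mxE eqxx mulr1n => e.
have E : @lshift 1 m 0 = (0 : 'I_m.+1) by exact: val_inj.
by rewrite -[RHS]e E.
Qed.

Lemma row_of_cons_pair n (x : RT) (y : n.-tuple RT) :
  row_of (cons_pair (x, y)) = vcons x (row_of y).
Proof.
suff : row_of (cons_pair (x, y)) = row_mx x%:M (row_of y) :> 'rV[R]_(1 + n) by [].
apply/rowP => i; rewrite mxE /cons_pair /=.
case: (split_ordP i) => k ->.
  rewrite row_mxEl (ord1 k) mxE mulr1n.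
  by rewrite (_ : @lshift 1 n _ = (ord0 : 'I_n.+1)) ?tnth0//; exact: val_inj.
rewrite row_mxEr (_ : rshift 1 k = (lift ord0 k : 'I_n.+1)) ?tnthS ?mxE//.
exact: val_inj.
Qed.

Lemma xsection_vcons n (S : set 'rV[R]_n.+1) (x : RT) :
  leb (xsection (@cons_pair R n @^-1` (@row_of n.+1 @^-1` S)) x) =
  vol [set y | S (vcons x y)].
Proof.
congr (leb _); rewrite /xsection.
apply/seteqP; split => y; rewrite /= inE /preimage /=;
  by rewrite row_of_cons_pair.
Qed.

Lemma measurable_cons_preimage n (S : set 'rV[R]_n.+1) : borel S ->
  measurable (@cons_pair R n @^-1` (@row_of n.+1 @^-1` S)).
Proof.
by move=> mS; rewrite -[X in measurable X]setTI; exact: (@measurable_cons_pair R n).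
Qed.

Lemma measurable_slice n (S : set 'rV[R]_n.+1) : borel S ->
  measurable_fun setT (fun x : RT => vol [set y | S (vcons x y)]).
Proof.
move=> mS; under eq_fun do rewrite -xsection_vcons.
have mE := measurable_cons_preimage mS.
exact: (measurable_fun_xsection (@leb n) mE).
Qed.

Lemma vol_fubini n (S : set 'rV[R]_n.+1) : borel S ->
  vol S = (\int[lambda]_x vol [set y | S (vcons x y)])%E.
Proof.
move=> /measurable_cons_preimage mE.
under eq_integral do rewrite -xsection_vcons.
rewrite /vol -[LHS]/((lambda \x^ @leb n)%E _).
rewrite -(product_measure_unique (m1 := lambda) (m2 := @leb n)
  (m' := (lambda \x^ @leb n)%E)) //.
by move=> A B mA mB; rewrite /= product_measure2E.
Qed.

End Volume.
Arguments eball {R} n r _.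

(** * The profile of a ridged ball *)

Section Ridge.
Variable R : realType.
Implicit Types (X : int -> bool) (xi p : R) (j : int).

(** Over the cell [j, j + 1), the graph of N^2 - xi^2 + ridge X xi consists of
two tangents of the parabola N^2 - xi^2, at the ends of the cell. This makes
the ridged ball convex. *)
Definition ridge X xi : R :=
  let j := Num.floor xi in
  if X j then Num.min (xi - j%:~R) (j%:~R + 1 - xi) ^+ 2 else 0.

(** The latitudes at which the ridged ball touches the sphere of radius N. *)
Definition tangent X p : Prop := forall j, X j -> ~ (j%:~R < p < j%:~R + 1).

Lemma floor_bounds xi : (Num.floor xi)%:~R <= xi < (Num.floor xi)%:~R + 1.
Proof. by have := floor_itv xi; rewrite intrD. Qed.

Lemma tangent_int X j : tangent X j%:~R.
Proof.
move=> i _ /andP[]; rewrite -[1]/(1%:~R) -intrD !ltr_int; lia.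
Qed.

(** Together with [ridge_attained]: the ridge is the squared distance to the
tangent latitudes, so the ridged ball is an intersection of paraboloids. *)
Lemma ridge_le X xi p : tangent X p -> ridge X xi <= (xi - p) ^+ 2.
Proof.
move=> Tp; rewrite /ridge; have /andP[f1 f2] := floor_bounds xi.
case: ifPn => [Xj|_]; last exact: sqr_ge0.
have [pj|jp] := leP p (Num.floor xi)%:~R.
  have h : Num.min (xi - (Num.floor xi)%:~R) ((Num.floor xi)%:~R + 1 - xi) <= xi - p.
    by rewrite ge_min; apply/orP; left; lra.
  by rewrite ler_pXn2r// nnegrE ?le_min; [apply/andP; split; lra|lra].
have [jp1|pj1] := leP ((Num.floor xi)%:~R + 1) p; last first.
  by case: (Tp _ Xj); rewrite jp pj1.
rewrite -[(xi - p) ^+ 2]sqrrN opprB.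
have h : Num.min (xi - (Num.floor xi)%:~R) ((Num.floor xi)%:~R + 1 - xi) <= p - xi.
  by rewrite ge_min; apply/orP; right; lra.
by rewrite ler_pXn2r// nnegrE ?le_min; [apply/andP; split; lra|lra].
Qed.

Lemma ridge_attained X xi : exists2 p, tangent X p & ridge X xi = (xi - p) ^+ 2.
Proof.
rewrite /ridge; have /andP[f1 f2] := floor_bounds xi.
case: ifPn => [Xj|nXj].
  have [h|h] := leP (xi - (Num.floor xi)%:~R) ((Num.floor xi)%:~R + 1 - xi).
    by exists (Num.floor xi)%:~R => //; exact: tangent_int.
  exists ((Num.floor xi + 1)%:~R); first exact: tangent_int.
  by rewrite intrD -sqrrN opprB.
exists xi; last by rewrite subrr expr0n.
move=> j Xj h; move: nXj; rewrite (_ : Num.floor xi = j) ?Xj//.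
by apply: floor_def; rewrite intrD; lra.
Qed.

Lemma ridge_ge0 X xi : 0 <= ridge X xi.
Proof. by have [p _ ->] := ridge_attained X xi; exact: sqr_ge0. Qed.

Lemma ridge_le4 X xi : ridge X xi <= 4^-1.
Proof.
rewrite /ridge; have /andP[f1 f2] := floor_bounds xi.
case: ifPn => [Xj|nXj]; last by rewrite invr_ge0.
rewrite (_ : 4^-1 = 2^-1 ^+ 2); last by field.
rewrite ler_pXn2r// ?nnegrE ?le_min ?ge_min.
- by apply/orP; have [] := leP xi ((Num.floor xi)%:~R + 2^-1); [left|right]; lra.
- by apply/andP; split; lra.
- by rewrite invr_ge0.
Qed.

Lemma ridge_eq X X' xi : X (Num.floor xi) = X' (Num.floor xi) ->
  ridge X xi = ridge X' xi.
Proof. by rewrite /ridge => ->. Qed.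

Lemma ridge_cell X j xi : 0 <= xi < 1 ->
  ridge X (xi + j%:~R) = if X j then Num.min xi (1 - xi) ^+ 2 else 0.
Proof.
move=> xi01; rewrite /ridge (_ : Num.floor _ = j).
  by case: ifP => // _; congr (Num.min _ _ ^+ 2); ring.
by apply: floor_def; rewrite intrD; lra.
Qed.

Lemma ridge_int X j : ridge X j%:~R = 0.
Proof.
by apply/le_anti; rewrite ridge_ge0 (le_trans (ridge_le _ (@tangent_int X j)))//
  subrr expr0n.
Qed.

(** The point reflection maps the open cell (j, j + 1) to (- j - 1, - j). *)
Definition mirror X : int -> bool := fun j => X (- j - 1).

(** At integers the reflection does not map cells to cells, but both ridges
vanish there. *)
Lemma ridge_mirror X xi : ridge (mirror X) (- xi) = ridge X xi.
Proof.
have /andP[f1 f2] := floor_bounds xi.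
have [e|ne] := eqVneq xi (Num.floor xi)%:~R.
  by rewrite e -mulrNz !ridge_int.
have f0 : (Num.floor xi)%:~R < xi by rewrite lt_neqAle eq_sym ne.
rewrite /ridge (_ : Num.floor (- xi) = - Num.floor xi - 1).
  rewrite /mirror (_ : - (- Num.floor xi - 1) - 1 = Num.floor xi); last by lia.
  case: ifP => // _; rewrite minC; congr (Num.min _ _ ^+ 2);
    by rewrite intrB mulrNz; ring.
by apply: floor_def; rewrite subrK intrB mulrNz; lra.
Qed.

End Ridge.
Arguments tangent_int {R} X j.

(** * Ridged balls are convex bodies of revolution *)

Section Body.
Variable R : realType.
Implicit Types (X : int -> bool) (n N : nat).

Lemma continuous_sumr (T : topologicalType) (I : Type) (s : seq I) (f : I -> T -> R) :
  (forall i, continuous (f i)) -> continuous (fun x => \sum_(i <- s) f i x).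
Proof.
move=> cf; elim: s => [|i s IH] x.
  by under eq_fun do rewrite big_nil; exact: cvg_cst.
by under eq_fun do rewrite big_cons; apply: cvgD; [exact: cf|exact: IH].
Qed.

Lemma continuous_dot n (b : 'rV[R]_n) : continuous (fun z => dot z b).
Proof.
under eq_fun do rewrite dot_sum.
apply: continuous_sumr => i x.
have h := @coord_continuous R 1 n 0 i x.
exact: (cvgM h (cvg_cst _)).
Qed.

Lemma continuous_dotxx n : continuous (fun z : 'rV[R]_n => dot z z).
Proof.
under eq_fun do rewrite dot_sum.
apply: continuous_sumr => i x.
have h := @coord_continuous R 1 n 0 i x.
exact: (cvgM h h).
Qed.

(** A section of the ridged ball by a hyperplane at distance t from the origin,
in the coordinates z of an orthonormal frame whose origin is the foot of the
perpendicular: b is the projection of the axis direction to the hyperplane,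
tau the latitude of the foot. *)
Definition sect n N X (b : 'rV[R]_n) (tau t : R) : set 'rV[R]_n :=
  [set z | dot z z + t ^+ 2 <= N%:R ^+ 2 + ridge X (dot z b + tau)].

Lemma sectP n N X (b : 'rV[R]_n) tau t z : sect N X b tau t z <->
  forall p, tangent X p ->
    dot z z + t ^+ 2 <= N%:R ^+ 2 + (dot z b + tau - p) ^+ 2.
Proof.
split=> [zS p Tp|zP]; first by rewrite (le_trans zS)// lerD2l ridge_le.
by have [p Tp e] := ridge_attained X (dot z b + tau); rewrite /sect /= e zP.
Qed.

Lemma closed_sect n N X (b : 'rV[R]_n) tau t : closed (sect N X b tau t).
Proof.
have -> : sect N X b tau t = \bigcap_(p in [set p | tangent X p])
    [set z | dot z z + t ^+ 2 - (dot z b + tau - p) ^+ 2 <= N%:R ^+ 2].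
  apply/seteqP; split => z /= => [/sectP h p Tp /=|h].
    by rewrite lerBlDr h.
  by apply/sectP => p Tp; rewrite -lerBlDr h.
apply: closed_bigI => p _.
rewrite (_ : [set z | _] = (fun z => dot z z + t ^+ 2 - (dot z b + tau - p) ^+ 2)
   @^-1` [set y | y <= N%:R ^+ 2]) //.
apply: preimage_closed; last exact: closed_le.
move=> z _; have h1 := @continuous_dotxx n z; have h2 := @continuous_dot n b z.
have h3 : (dot x b + tau - p) @[x --> z] --> dot z b + tau - p.
  exact: (cvgB (cvgD h2 (cvg_cst tau)) (cvg_cst p)).
exact: (cvgB (cvgD h1 (cvg_cst (t ^+ 2))) (cvgM h3 h3)).
Qed.

Lemma borel_sect n N X (b : 'rV[R]_n) tau t : borel (sect N X b tau t).
Proof. by apply: closed_borel; exact: closed_sect. Qed.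

Lemma sphere_sect n N X (b : 'rV[R]_n) tau t :
  [set z | dot z z + t ^+ 2 <= N%:R ^+ 2] `<=` sect N X b tau t.
Proof. by move=> z /= zN; rewrite /sect /= (le_trans zN)// lerDl ridge_ge0. Qed.

Definition body n N X : set 'rV[R]_n.+1 :=
  [set x | dot x x <= N%:R ^+ 2 + ridge X (x 0 0)].

Lemma body_sect n N X : @body n N X = sect N X (delta_mx 0 0) 0 0.
Proof.
by apply: eq_set => x; rewrite dot_delta expr0n/= !addr0.
Qed.

Lemma bodyP n N X (x : 'rV[R]_n.+1) : body N X x <->
  forall p, tangent X p -> dot x x <= N%:R ^+ 2 + (x 0 0 - p) ^+ 2.
Proof.
rewrite body_sect sectP; split => h p /h; by rewrite dot_delta expr0n/= !addr0.
Qed.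

Lemma closed_body n N X : closed (@body n N X).
Proof. rewrite body_sect; exact: closed_sect. Qed.

(** The latitudes 0, N and - N are tangent for every X, which keeps the body
inside the cube circumscribed to the sphere. *)
Lemma body_cube n N X (x : 'rV[R]_n.+1) i : (0 < N)%N -> body N X x ->
  `|x 0 i| <= N%:R.
Proof.
move=> N0 /bodyP xB; have N0' : 0 < N%:R :> R by rewrite ltr0n.
have x0 := coord_dot x 0.
have [->|i0] := eqVneq i 0.
  have h1 := xB _ (tangent_int X N%:Z).
  have h2 := xB _ (tangent_int X (- N%:Z)).
  rewrite mulrNz -pmulrn in h2; rewrite -pmulrn in h1.
  by rewrite ler_norml; apply/andP; split; nra.
have := xB _ (tangent_int X 0); rewrite mulr0z subr0 => h.
have := le_trans (coord2_dot x i0) h; rewrite lerD2r => h'.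
by rewrite ler_norml; apply/andP; split; nra.
Qed.

Lemma ball_body n N X : eball n.+1 (N%:R ^+ 2 : R) `<=` body N X.
Proof. by move=> x xB; rewrite /body /= (le_trans xB)// lerDl ridge_ge0. Qed.

Lemma compact_body n N X : (0 < N)%N -> compact (@body n N X).
Proof.
move=> N0; apply: bounded_closed_compact; last exact: closed_body.
exists N%:R; split; first exact: num_real.
move=> M NM x xB /=; rewrite /Num.norm /= mx_normrE.
apply: bigmax_le => [|[i j] _]; first by rewrite (le_trans _ (ltW NM)).
by rewrite (ord1 i) (le_trans (body_cube _ N0 xB))// ltW.
Qed.

(** Convexity holds paraboloid by paraboloid, since |x|^2 - x_0^2 is a convex
function of x. *)
Lemma convex_body_body n N X : (0 < N)%N -> convex_body (@body n N X).
Proof.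
move=> N0; split; first exact: compact_body.
- apply/convex_setW => x y; rewrite !inE => xB yB l l0 l1; rewrite inE.
  apply/bodyP => p Tp.
  have /bodyP/(_ p Tp) := xB; have /bodyP/(_ p Tp) := yB.
  have := coord_dot (x - y) 0.
  rewrite /conv /= /unstable.onem => h hy hx.
  move: (l%:num) l0 l1 => s s0 s1 in h hy hx *.
  rewrite [X in (X - p) ^+ 2]mxE [X in (X + _ - p) ^+ 2]mxE [X in (_ + X - p) ^+ 2]mxE.
  move: h; rewrite ![(x - y) _ _]mxE [(- y) _ _]mxE.
  rewrite !(dotDl, dotDr, dotZl, dotZr, dotNl, dotNr) (dotC y x).
  move: (dot x x) (dot y y) (dot x y) (x 0 0) (y 0 0) hx hy.
  move=> Dx Dy Dxy a b hx hy h.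
  (* The sum of these three inequalities is the claim. *)
  have e1 : 0 <= s * (N%:R ^+ 2 + (a - p) ^+ 2 - Dx) by rewrite mulr_ge0 ?subr_ge0// ltW.
  have e2 : 0 <= (1 - s) * (N%:R ^+ 2 + (b - p) ^+ 2 - Dy) by rewrite mulr_ge0 ?subr_ge0// ltW.
  have e3 : 0 <= s * (1 - s) * (Dx + - Dxy + (- Dxy - - Dy) - (a - b) ^+ 2).
    by rewrite mulr_ge0 ?mulr_ge0 ?subr_ge0// ?ltW.
  by nra.
- exists 0; rewrite /interior /=.
  have : open [set x : 'rV[R]_n.+1 | dot x x < N%:R ^+ 2].
    rewrite (_ : [set x | _] = (fun x => dot x x) @^-1` [set y | y < N%:R ^+ 2])//.
    by apply: open_comp; [move=> x _; exact: continuous_dotxx|exact: open_lt].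
  rewrite openE => /(_ 0) /=; rewrite dot0l exprn_gt0 ?ltr0n// => /(_ isT).
  by apply: filterS => x /ltW xN; apply: ball_body.
Qed.

Lemma revolution_body n N X : body_of_revolution (@body n N X).
Proof.
exists 0, (delta_mx 0 0); split.
  apply/eqP => /matrixP/(_ 0 0); rewrite !mxE !eqxx => /eqP; rewrite oner_eq0//.
move=> Q QQ _ vQ.
have QQ' : Q^T *m Q = 1%:M by exact: mulmx1C.
have vQ' : delta_mx 0 0 *m Q^T = delta_mx 0 0 :> 'rV[R]_n.+1.
  by rewrite -[in LHS]vQ -mulmxA QQ mulmx1.
have E M (x : 'rV[R]_n.+1) : M *m M^T = 1%:M -> delta_mx 0 0 *m M^T = delta_mx 0 0 :> 'rV[R]_n.+1 ->
    body N X x -> body N X (x *m M).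
  move=> MM vM; rewrite /body /= -!dot_delta !dotM vM.
  by rewrite -mulmxA MM mulmx1.
apply/seteqP; split => [_ [x xB <-]|x xB]; first by rewrite subr0 add0r; exact: E.
exists (x *m Q^T); last by rewrite subr0 add0r -mulmxA QQ' mulmx1.
by apply: E => //; rewrite trmxK.
Qed.

End Body.

(** * Sections and shadows in an orthonormal frame of the hyperplane *)

Section Slab.
Variable R : realType.
Implicit Types (X : int -> bool) (n N : nat) (j : int).

Lemma continuous_mulmx m n (M : 'M[R]_(m, n)) : continuous (fun x : 'rV[R]_m => x *m M).
Proof.
move=> x B /nbhs_ballP[e /= e0 eB].
have h (j : 'I_n) : \forall y \near x, ball ((x *m M) 0 j) e ((y *m M) 0 j).
  have E (y : 'rV[R]_m) : (y *m M) 0 j = dot y (col j M)^T.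
    by rewrite dot_sum mxE; apply: eq_bigr => i _; rewrite !mxE.
  have hy : \forall y \near x, ball (dot x (col j M)^T) e (dot y (col j M)^T).
    exact: (@continuous_dot R m (col j M)^T x _ (nbhsx_ballx _ _ e0)).
  by near=> y; rewrite !E; near: y.
have h2 : \forall y \near x, forall j : 'I_n, ball ((x *m M) 0 j) e ((y *m M) 0 j).
  exact: (filter_forall (nbhs_filter x) h).
suff : \forall y \near x, B (y *m M) by [].
near=> y; apply: eB; split => // i j; rewrite (ord1 i).
by move: j; near: y.
Unshelve. all: by end_near.
Qed.

Lemma vol_split n (A S : set 'rV[R]_n) : borel A -> borel S ->
  vol A = (vol (A `\` S) + vol (A `&` S))%E.
Proof. by move=> mA mS; exact: measureDI. Qed.

(** Cut both sets along S and reflect the pieces inside S. *)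
Lemma vol_swap_slab n (S A1 A2 : set 'rV[R]_n) :
  borel S -> borel A1 -> borel A2 -> (forall z, S (- z) <-> S z) ->
  (forall z, ~ S z -> A1 z <-> A2 z) -> (forall z, S z -> A1 z <-> A2 (- z)) ->
  vol A1 = vol A2.
Proof.
move=> mS mA1 mA2 SN A12 A12S.
rewrite (vol_split mA1 mS) (vol_split mA2 mS); congr (_ + _)%E.
  congr vol; apply/seteqP; split => z [Az Sz]; split => //; exact/(A12 z Sz).
rewrite -(@vol_opp R n (A2 `&` S)); last exact: measurableI.
congr vol; apply/seteqP; split => z [Az Sz]; split.
- exact: (proj1 (A12S z Sz)).
- exact: (proj2 (SN z)).
- exact: (proj2 (A12S z (proj1 (SN z) Sz))).
- exact: (proj1 (SN z)).
Qed.

End Slab.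

Section Frame.
Variables (R : realType) (n : nat) (u : 'rV[R]_n.+1) (B : 'M[R]_(n, n.+1)).
Hypotheses (su : sphere u) (Bu : perp_basis u B).

Lemma dot_uu : dot u u = 1.
Proof. by rewrite -[LHS]sqr_sqrtr ?dot_ge0// [Num.sqrt _]su expr1n. Qed.

Lemma frame_orthogonal : (col_mx u B : 'M[R]_(1 + n, n.+1)) *m (col_mx u B)^T = 1%:M.
Proof.
have [BB Bu0] := Bu.
rewrite tr_col_mx mul_col_row BB Bu0 (_ : u *m B^T = 0); last first.
  by rewrite -[LHS]trmxK trmx_mul trmxK Bu0 trmx0.
by rewrite [u *m u^T]mx11_scalar -/(dot u u) dot_uu -scalar_mx_block.
Qed.

Lemma frame_decomp (x : 'rV[R]_n.+1) : x = x *m B^T *m B + dot x u *: u.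
Proof.
have := mulmx1C frame_orthogonal; rewrite tr_col_mx mul_row_col => e.
rewrite -[LHS]mulmx1 -e mulmxDr !mulmxA addrC; congr (_ + _).
by rewrite [x *m u^T]mx11_scalar mul_scalar_mx.
Qed.

(** The projection of the axis direction, in the coordinates of the frame. *)
Definition frame_axis : 'rV[R]_n := delta_mx 0 0 *m B^T.

Lemma dot_frame_axis (z : 'rV[R]_n) : dot z frame_axis = (z *m B) 0 0.
Proof. by rewrite dotC /frame_axis dotM trmxK dotC dot_delta. Qed.

Lemma frame_point0 (z : 'rV[R]_n) t :
  (z *m B + t *: u) 0 0 = dot z frame_axis + t * u 0 0.
Proof. by rewrite dot_frame_axis !mxE. Qed.

Lemma frame_point_perp (z : 'rV[R]_n) : dot (z *m B) u = 0.
Proof. by have [_ Bu0] := Bu; rewrite /dot -mulmxA Bu0 mulmx0 mxE. Qed.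

Lemma frame_pointK (z : 'rV[R]_n) t : (z *m B + t *: u) *m B^T = z.
Proof.
have [BB Bu0] := Bu.
rewrite mulmxDl -mulmxA BB mulmx1 -scalemxAl (_ : u *m B^T = 0) ?scaler0 ?addr0//.
by rewrite -[LHS]trmxK trmx_mul trmxK Bu0 trmx0.
Qed.

Lemma frame_point_norm (z : 'rV[R]_n) t :
  dot (z *m B + t *: u) (z *m B + t *: u) = dot z z + t ^+ 2.
Proof.
have [BB Bu0] := Bu.
rewrite !(dotDl, dotDr, dotZl, dotZr) frame_point_perp (dotC u) frame_point_perp.
by rewrite dot_uu dotM -mulmxA BB mulmx1; ring.
Qed.

Lemma frame_sect N (X : int -> bool) (z : 'rV[R]_n) t :
  body N X (z *m B + t *: u) <-> sect N X frame_axis (t * u 0 0) t z.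
Proof. by rewrite /body /= frame_point_norm frame_point0. Qed.

End Frame.

Section Sections.
Variables (R : realType) (n : nat).
Implicit Types (u : 'rV[R]_n.+1) (X : int -> bool) (N : nat).

Lemma hyperplane_volE u (S : set 'rV[R]_n.+1) :
  hyperplane_vol u S = vol [set x *m (perp_frame u)^T | x in S].
Proof.
rewrite /hyperplane_vol /vol -[RHS]/(lebesgueRn R n _).
congr (lebesgueRn R n _); apply/seteqP; split => t [x Sx h]; exists x => //.
  by rewrite -h; apply/rowP => i; rewrite [RHS]mxE tnth_mktuple.
by apply: eq_from_tnth => i; rewrite tnth_mktuple h mxE.
Qed.

Definition axis_of u := frame_axis (perp_frame u).

Lemma section_vol u t N X : sphere u ->
  hyperplane_vol u (body N X `&` hyperplane u t) =
  vol (sect N X (axis_of u) (t * u 0 0) t).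
Proof.
move=> su; have Bu := perp_frameP su; rewrite hyperplane_volE; congr vol.
apply/seteqP; split => z.
  move=> [x [xB [y yu yx]] <-].
  have yE : y *m (perp_frame u)^T *m perp_frame u = y.
    by rewrite [RHS](frame_decomp su Bu) [dot y u]yu scale0r addr0.
  rewrite -yx -yE (frame_pointK Bu); apply/(frame_sect su Bu).
  by rewrite yE yx.
move=> /(frame_sect su Bu) zB.
exists (z *m perp_frame u + t *: u); last exact: frame_pointK.
split => //; exists (z *m perp_frame u) => //; exact: frame_point_perp.
Qed.

Lemma central_vol u N X : sphere u ->
  central_section (body N X) u = vol (sect N X (axis_of u) 0 0).
Proof.
move=> su; rewrite -{1}(mul0r (u 0 0)) -section_vol//; congr hyperplane_vol.
congr (_ `&` _); apply/seteqP; split => x.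
  by move=> xu; exists x => //; rewrite scale0r addr0.
by move=> [y yu <-]; rewrite scale0r addr0.
Qed.

(** The projection along a direction u in frame coordinates: t moves along the
fibre, and c is the component of u on the axis. *)
Definition shadow N X (b : 'rV[R]_n) (c : R) : set 'rV[R]_n :=
  [set z | exists t, sect N X b (t * c) t z].

Lemma shadow_image u N X : sphere u ->
  [set x *m (perp_frame u)^T | x in body N X] = shadow N X (axis_of u) (u 0 0).
Proof.
move=> su; have Bu := perp_frameP su; apply/seteqP; split => z.
  move=> [x xB <-]; exists (dot x u); apply/(frame_sect su Bu).
  by rewrite -(frame_decomp su Bu).
move=> [t /(frame_sect su Bu) zB].
by exists (z *m perp_frame u + t *: u) => //; exact: frame_pointK.
Qed.

Lemma borel_shadow u N X : (0 < N)%N -> sphere u ->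
  borel (shadow N X (axis_of u) (u 0 0)).
Proof.
move=> N0 su; rewrite -shadow_image//; apply: closed_borel.
apply: compact_closed; first exact: norm_hausdorff.
apply: continuous_compact; last exact: compact_body.
by apply: continuous_subspaceT; exact: continuous_mulmx.
Qed.

Lemma projection_volE u N X : sphere u ->
  projection_vol (body N X) u = vol (shadow N X (axis_of u) (u 0 0)).
Proof.
move=> su; have Bu := perp_frameP su.
rewrite /projection_vol hyperplane_volE -shadow_image//; congr vol.
have E (x : 'rV[R]_n.+1) : proj_perp u x *m (perp_frame u)^T = x *m (perp_frame u)^T.
  rewrite /proj_perp mulmxBl -scalemxAl (_ : u *m _ = 0) ?scaler0 ?subr0//.
  by rewrite -[LHS]trmxK trmx_mul trmxK (proj2 Bu) trmx0.
apply/seteqP; split => z.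
  by move=> [_ [x xB <-] <-]; exists x => //; rewrite E.
by move=> [x xB <-]; exists (proj_perp u x); [exists x|rewrite E].
Qed.

End Sections.

(** * Moving a ridge to the mirror cell *)

Section Flip.
Variable R : realType.
Implicit Types (X : int -> bool) (n N : nat) (j : int).

Definition flipped (a : int) X1 X2 : Prop :=
  [/\ forall j, j != a -> j != - a - 1 -> X1 j = X2 j,
      X1 a = X2 (- a - 1) & X1 (- a - 1) = X2 a].

Variables (a : int) (X1 X2 : int -> bool).
Hypotheses (a0 : 0 <= a) (fl : flipped a X1 X2).

(** The ends of the cells are left out: there the ridges of all patterns
vanish. *)
Definition in_slab (xi : R) : Prop := a%:~R < `|xi| < a%:~R + 1.

Lemma ridge_out (xi : R) : ~ in_slab xi -> ridge X1 xi = ridge X2 xi.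
Proof.
move=> nS; have [fl1 _ _] := fl; have /andP[f1 f2] := floor_bounds xi.
have a0' : 0 <= a%:~R :> R by rewrite ler0z.
have [e|ne] := eqVneq (Num.floor xi) a.
  rewrite e in f1 f2; suff -> : xi = a%:~R by rewrite !ridge_int.
  apply/eqP; rewrite eq_le f1 andbT leNgt; apply/negP => h.
  by apply: nS; rewrite /in_slab ger0_norm; [apply/andP; split; lra|lra].
have [e|ne'] := eqVneq (Num.floor xi) (- a - 1).
  rewrite e intrB mulrNz in f1 f2.
  suff -> : xi = (- a - 1)%:~R by rewrite !ridge_int.
  apply/eqP; rewrite eq_le intrB mulrNz f1 andbT leNgt; apply/negP => h.
  apply: nS; rewrite /in_slab ltr0_norm; last by lra.
  by apply/andP; split; lra.
by apply: ridge_eq; exact: fl1.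
Qed.

Lemma ridge_in (xi : R) : in_slab xi -> ridge X1 xi = ridge X2 (- xi).
Proof.
rewrite /in_slab => /andP[s1 s2]; have [_ fl2 fl3] := fl.
rewrite -[RHS]ridge_mirror opprK; apply: ridge_eq; rewrite /mirror.
have a0' : 0 <= a%:~R :> R by rewrite ler0z.
have [x0|x0] := leP 0 xi.
  rewrite ger0_norm// in s1 s2; rewrite (@floor_def _ _ a)//.
  by rewrite intrD; lra.
rewrite ltr0_norm// in s1 s2; rewrite (@floor_def _ _ (- a - 1)).
  by rewrite fl3; congr X2; lia.
by rewrite subrK intrB mulrNz; apply/andP; split; lra.
Qed.

Lemma in_slabN (xi : R) : in_slab (- xi) <-> in_slab xi.
Proof. by rewrite /in_slab normrN. Qed.

Lemma borel_slab n (b : 'rV[R]_n) : borel [set z | in_slab (dot z b)].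
Proof.
rewrite /borel (_ : _ @^-1` _ = (fun t => dot (row_of t) b) @^-1`
    (`]a%:~R, (a%:~R + 1)[%classic `|` `](- a%:~R - 1), (- a%:~R)[%classic)).
  rewrite -[X in measurable X]setTI.
  have mf := measurable_dot (@measurable_row_of R n) (fun i => measurable_cst (b 0 i)).
  apply: (mf measurableT); apply: measurableU; exact: measurable_itv.
apply/seteqP; split => t; rewrite /preimage /= !in_itv/= /in_slab.
  have [x0|x0] := leP 0 (dot (row_of t) b).
    by rewrite ger0_norm//; left.
  rewrite ltr0_norm// => /andP[h1 h2]; right; apply/andP; split; lra.
have a0' : 0 <= a%:~R :> R by rewrite ler0z.
move=> [|] /andP[h1 h2].
  by rewrite ger0_norm; [apply/andP; split; lra|lra].
by rewrite ltr0_norm; [apply/andP; split; lra|lra].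
Qed.

(** As the hyperplane contains the origin, z -> - z maps the part of the section
over one outer cell to the part over the other. *)
Lemma vol_central_flip n N (b : 'rV[R]_n) :
  vol (sect N X1 b 0 0) = vol (sect N X2 b 0 0).
Proof.
apply: (vol_swap_slab (borel_slab b)); [exact: borel_sect|exact: borel_sect|..].
- by move=> z /=; rewrite dotNl; exact: in_slabN.
- by move=> z /= zS; rewrite /sect /= addr0 (ridge_out zS).
- move=> z /= zS; rewrite /sect /= !addr0 (ridge_in zS).
  by rewrite !dotNl dotNr opprK.
Qed.

(** Suppose that an integer j separates the latitude of z from the latitude of
the point of the fibre at t. Then the latter differs from j by at most |t c|,
and the paraboloid at j gives |z|^2 + t^2 <= N^2 + (t c)^2 <= N^2 + t^2. *)
Lemma shadow_local n N X (b z : 'rV[R]_n) (c : R) : c ^+ 2 <= 1 ->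
  shadow N X b c z -> dot z z <= N%:R ^+ 2 \/
  exists2 t, sect N X b (t * c) t z &
    forall j, (j%:~R < dot z b /\ j%:~R < dot z b + t * c) \/
              (dot z b < j%:~R /\ dot z b + t * c < j%:~R).
Proof.
move=> c1 [t zt].
have [[j hj]|h] := pselect (exists j : int,
   ~ ((j%:~R < dot z b /\ j%:~R < dot z b + t * c) \/
      (dot z b < j%:~R /\ dot z b + t * c < j%:~R))); last first.
  by right; exists t => // j; apply: contrapT => nj; apply: h; exists j.
left; move/sectP : zt => /(_ _ (tangent_int X j)).
set y := j%:~R in hj *; set xi := dot z b in hj *.
have : (xi + t * c - y) ^+ 2 <= (t * c) ^+ 2.
  have [h1|h1] := leP xi y; have [h2|h2] := leP (xi + t * c) y.
  - suff : y = xi \/ y = xi + t * c by move=> [|] ->; nra.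
    have [e|ne] := eqVneq y xi; first by left.
    have [e|ne'] := eqVneq y (xi + t * c); first by right.
    by exfalso; apply: hj; right; rewrite !lt_neqAle eq_sym ne h1 eq_sym ne' h2.
  - by nra.
  - by nra.
  - by exfalso; apply: hj; left.
have : (t * c) ^+ 2 <= t ^+ 2 by rewrite exprMn ler_piMr ?sqr_ge0.
lra.
Qed.

Lemma shadow_ball n N X (b z : 'rV[R]_n) c : dot z z <= N%:R ^+ 2 ->
  shadow N X b c z.
Proof.
by move=> h; exists 0; apply: sphere_sect; rewrite /= expr0n addr0.
Qed.

Lemma slab_local (xi xi' : R) :
  (forall j, (j%:~R < xi /\ j%:~R < xi') \/ (xi < j%:~R /\ xi' < j%:~R)) ->
  in_slab xi -> in_slab xi'.
Proof.
have a0' : 0 <= a%:~R :> R by rewrite ler0z.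
move=> h; have := h a; have := h (a + 1); have := h (- a); have := h (- a - 1).
rewrite intrB intrD mulrNz /in_slab => h1 h2 h3 h4.
have [x0|x0] := leP 0 xi.
  rewrite ger0_norm// => /andP[h5 h6].
  by rewrite ger0_norm; [apply/andP; split; lra|lra].
rewrite ltr0_norm// => /andP[h5 h6].
by rewrite ltr0_norm; [apply/andP; split; lra|lra].
Qed.

End Flip.

Lemma flipped_sym a X1 X2 : flipped a X1 X2 -> flipped a X2 X1.
Proof. by case=> h1 h2 h3; split => // j ja ja'; rewrite h1. Qed.

Section FlipShadow.
Variable R : realType.
Implicit Types (n N : nat) (j : int).

Lemma slab_localE (a : int) (xi xi' : R) : 0 <= a ->
  (forall j, (j%:~R < xi /\ j%:~R < xi') \/ (xi < j%:~R /\ xi' < j%:~R)) ->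
  in_slab a xi <-> in_slab a xi'.
Proof.
move=> a0 h; split; first exact: slab_local.
apply: slab_local => // j; by case: (h j) => -[]; [left|right].
Qed.

Lemma shadow_out a X1 X2 n N (b z : 'rV[R]_n) c : 0 <= a -> flipped a X1 X2 ->
  c ^+ 2 <= 1 -> ~ in_slab a (dot z b) -> shadow N X1 b c z -> shadow N X2 b c z.
Proof.
move=> a0 fl c1 zS /(shadow_local c1)[h|[t zt h]]; first exact: shadow_ball.
exists t; rewrite /sect /= -(ridge_out a0 fl)//.
by move=> /(slab_localE a0 h).
Qed.

Lemma shadow_in a X1 X2 n N (b z : 'rV[R]_n) c : 0 <= a -> flipped a X1 X2 ->
  c ^+ 2 <= 1 -> in_slab a (dot z b) -> shadow N X1 b c z -> shadow N X2 b c (- z).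
Proof.
move=> a0 fl c1 zS /(shadow_local c1)[h|[t zt h]].
  by apply: shadow_ball; rewrite dotNl dotNr opprK.
exists (- t); rewrite /sect /= sqrrN !dotNl dotNr opprK mulNr -opprD.
by rewrite -(ridge_in a0 fl)//; exact/(slab_localE a0 h).
Qed.

(** By [shadow_local], the shadows outside the ball of radius N are determined
cell by cell, like the central sections. *)
Lemma vol_shadow_flip a X1 X2 n N (b : 'rV[R]_n) c : 0 <= a -> flipped a X1 X2 ->
  c ^+ 2 <= 1 -> borel (shadow N X1 b c) -> borel (shadow N X2 b c) ->
  vol (shadow N X1 b c) = vol (shadow N X2 b c).
Proof.
move=> a0 fl c1 m1 m2; have fl' := flipped_sym fl.
apply: (vol_swap_slab (borel_slab a0 b)) => //.
- by move=> z /=; rewrite dotNl; exact: in_slabN.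
- by move=> z /= zS; split; [exact: (shadow_out a0 fl)|exact: (shadow_out a0 fl')].
- move=> z /= zS; split; first exact: (shadow_in a0 fl).
  move=> /(shadow_in a0 fl' c1); rewrite opprK; apply.
  by rewrite dotNl; exact/in_slabN.
Qed.

Lemma vol_sect_mirror n N X (b : 'rV[R]_n) tau t :
  vol (sect N X b tau t) = vol (sect N (mirror X) b (- tau) (- t)).
Proof.
rewrite -(@vol_opp R n (sect N X b tau t)); last exact: borel_sect.
congr vol; apply: eq_set => z; rewrite /sect /= dotNl dotNr opprK sqrrN.
by rewrite !dotNl -[in LHS]ridge_mirror opprD opprK.
Qed.

End FlipShadow.

(** * Thue-Morse signs *)

Section ThueMorse.

(** The value true stands for the sign + 1. *)
Fixpoint thue_morse (k : nat) : seq bool :=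
  if k is k'.+1 then thue_morse k' ++ map negb (thue_morse k') else [:: true].

Lemma size_thue_morse k : size (thue_morse k) = (2 ^ k)%N.
Proof. by elim: k => //= k IH; rewrite size_cat size_map IH addnn expnS mul2n. Qed.

Lemma nth_thue_morse0 k : nth false (thue_morse k) 0.
Proof. by elim: k => //= k IH; rewrite nth_cat size_thue_morse expn_gt0. Qed.

Lemma rev_thue_morse k : rev (thue_morse k) = map (addb (odd k)) (thue_morse k).
Proof.
elim: k => //= k IH; rewrite rev_cat -map_rev IH map_cat -!map_comp.
by congr (_ ++ _); apply: eq_map => b /=; case: b; case: (odd k).
Qed.

(** The reason why the mirror images of the middle cells are the complementary
ones. *)
Lemma nth_thue_morse_rev k i : odd k -> (i < 2 ^ k)%N ->
  nth false (thue_morse k) (2 ^ k - i.+1) = ~~ nth false (thue_morse k) i.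
Proof.
move=> ok ik; rewrite -[in LHS](size_thue_morse k) -nth_rev ?size_thue_morse//.
by rewrite rev_thue_morse (nth_map false) ?size_thue_morse// ok addTb.
Qed.

Variable R : idomainType.

Lemma poly_difference (c : R) k (p : {poly R}) : (size p <= k.+1)%N ->
  exists2 q : {poly R}, (size q <= k)%N & forall y, q.[y] = p.[y] - p.[y + c].
Proof.
elim: k p => [|k IH] p sp.
  exists 0; first by rewrite size_poly0.
  by move=> y; rewrite horner0 (size1_polyC sp) !hornerC subrr.
elim/poly_ind : p sp => [_|r c0 _ sp].
  by exists 0 => [|y]; rewrite ?size_poly0// !horner0 subrr.
have sr : (size r <= k.+1)%N.
  have [->|r0] := eqVneq r 0; first by rewrite size_poly0.
  by move: sp; rewrite size_MXaddC (negPf r0).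
have [q sq qE] := IH r sr.
(* Here p = r X + c0, and r(y + c) = r(y) - q(y). *)
exists (q * 'X - c *: (r - q)) => [|y]; last first.
  by rewrite !hornerE !qE; ring.
apply: (leq_trans (size_polyD _ _)); rewrite geq_max; apply/andP; split.
  have [->|q0] := eqVneq q 0; first by rewrite mul0r size_poly0.
  by rewrite size_mulX.
rewrite size_polyN (leq_trans (size_scale_leq _ _))//.
apply: (leq_trans (size_polyD _ _)); rewrite geq_max sr size_polyN.
exact: leq_trans sq _.
Qed.

(** The signed sum of p over 2^(k+1) terms is the signed sum over 2^k terms of
p(y) - p(y + 2^k), which has a smaller degree. *)
Lemma prouhet k (p : {poly R}) y : (size p <= k)%N ->
  \sum_(i < 2 ^ k | nth false (thue_morse k) i) p.[y + i%:R] =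
  \sum_(i < 2 ^ k | ~~ nth false (thue_morse k) i) p.[y + i%:R].
Proof.
elim: k p y => [|k IH] p y sp.
  have -> : p = 0 by apply/eqP; rewrite -size_poly_eq0 -leqn0.
  by rewrite !big1// => i _; rewrite horner0.
pose S (f : nat -> bool) z := \sum_(i < 2 ^ k | f i) p.[z + i%:R].
have split_sum (b : bool) :
  \sum_(i < 2 ^ k.+1 | nth false (thue_morse k.+1) i == b) p.[y + i%:R] =
    S (fun i => nth false (thue_morse k) i == b) y +
    S (fun i => nth false (thue_morse k) i == ~~ b) (y + (2 ^ k)%:R).
  rewrite -(big_mkord (fun i => nth false (thue_morse k.+1) i == b) (fun i => p.[y + i%:R])).
  rewrite (@big_cat_nat _ _ _ (2 ^ k))//=; last by rewrite leq_exp2l.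
  congr (_ + _); rewrite /S.
    rewrite big_mkord; apply: eq_bigl => i.
    by rewrite nth_cat size_thue_morse ltn_ord.
  rewrite -{1}[(2 ^ k)%N]add0n big_addn expnS mul2n -addnn addnK big_mkord.
  apply: eq_big => i; last by rewrite natrD [(i%:R + _)]addrC addrA.
  rewrite nth_cat size_thue_morse ltnNge leq_addl /= addnK (nth_map false) ?size_thue_morse//.
  by case: nth; case: b.
have [q sq qE] := poly_difference (2 ^ k)%:R sp.
have h := IH q y sq.
have hq (f : nat -> bool) : \sum_(i < 2 ^ k | f i) q.[y + i%:R] = S f y - S f (y + (2 ^ k)%:R).
  rewrite /S -sumrB; apply: eq_bigr => i _; rewrite qE.
  by rewrite addrAC.
move: (split_sum true) (split_sum false).
under eq_bigl do rewrite eqb_id.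
move=> ->; under eq_bigl do rewrite eqbF_neg.
move=> ->.
move: h; rewrite (hq (fun i => nth false (thue_morse k) i))
  (hq (fun i => ~~ nth false (thue_morse k) i)).
have E1 : S (fun i => nth false (thue_morse k) i == true) =1
    S (fun i => nth false (thue_morse k) i).
  by move=> z; rewrite /S; apply: eq_bigl => i; rewrite eqb_id.
have E2 : S (fun i => nth false (thue_morse k) i == false) =1
    S (fun i => ~~ nth false (thue_morse k) i).
  by move=> z; rewrite /S; apply: eq_bigl => i; rewrite eqbF_neg.
rewrite !E1 !E2 => /eqP; rewrite subr_eq => /eqP ->.
by ring.
Qed.

End ThueMorse.

(** * Exchanging ridges by the Prouhet identity *)

Section Cells.
Variable R : realType.
Local Notation RT := (measurableTypeR R).
Local Notation lambda := (@lebesgue_measure R).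
Implicit Types (X : int -> bool) (n m N : nat) (j : int).

(** Here the parity of the dimension enters: the volume is a polynomial in the
squared radius. *)
Lemma vol_ball_even q : exists c : R, forall r, 0 < r ->
  vol (eball q.*2 r) = (c * r ^+ q)%:E.
Proof.
have [c c0 cE] := vol_unit_ball R q.*2; exists c => r r0.
rewrite -{1}[r]sqr_sqrtr ?ltW// vol_eball ?sqrtr_gt0// cE -EFinM.
by rewrite -mul2n exprM sqr_sqrtr ?ltW// mulrC.
Qed.

Definition cell n (s tau : R) (j : int) : set 'rV[R]_n.+1 :=
  [set z | j%:~R <= s * z 0 0 + tau < j%:~R + 1].

Lemma borel_band n (s tau a b : R) :
  borel [set z : 'rV[R]_n.+1 | a <= s * z 0 0 + tau < b].
Proof.
rewrite /borel (_ : _ @^-1` _ = (fun t : n.+1.-tuple RT =>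
    s * row_of t 0 0 + tau : RT) @^-1` `[a, b[%classic); last first.
  by apply/seteqP; split => t; rewrite /preimage /= in_itv.
rewrite -[X in measurable X]setTI.
have mf : measurable_fun setT (fun t : n.+1.-tuple RT => s * row_of t 0 0 + tau : RT).
  apply: measurable_funD; last exact: measurable_cst.
  by apply: measurable_funM; [exact: measurable_cst|exact: measurable_row_of].
exact: (mf measurableT _ (measurable_itv _)).
Qed.

Lemma borel_cell n s tau j : borel (@cell n s tau j).
Proof. exact: borel_band. Qed.

Definition window n (s tau : R) (j : int) (k : nat) : set 'rV[R]_n.+1 :=
  [set z | j%:~R <= s * z 0 0 + tau < j%:~R + k%:R].

Lemma vol_window n s tau j k (S : set 'rV[R]_n.+1) : borel S ->
  vol (S `&` window s tau j k) =
  (\sum_(i < k) vol (S `&` cell s tau (j + i%:Z)))%E.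
Proof.
move=> mS; elim: k => [|k IH].
  rewrite big_ord0 (_ : _ `&` _ = set0); first exact: measure0.
  by apply/seteqP; split => z // [_]; rewrite /window /= addr0; lra.
rewrite big_ord_recr /= -IH.
have mW k' : borel (@window n s tau j k') by exact: borel_band.
have mI : borel (S `&` window s tau j k.+1) by exact: measurableI (mW _).
rewrite (vol_split mI (mW k)) addeC.
have k0 : 0 <= k%:R :> R by [].
apply: (@f_equal2 _ _ _ adde); congr vol; apply/seteqP; split => z /=.
- by move=> [[]].
- move=> [Sz wz]; split => //; split => //.
  by move: wz; rewrite /window /= -natr1; lra.
- move=> [[Sz wz] nz]; split => //; move: wz nz; rewrite /window /cell /=.
  rewrite intrD -pmulrn -natr1 => /andP[h1 h2] /negP; rewrite h1 /= -leNgt.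
  by move=> h3; apply/andP; split; lra.
- rewrite /cell /= intrD -pmulrn => -[Sz /andP[h1 h2]]; split.
    by split => //; rewrite /window /= -natr1; lra.
  by rewrite /window /= => /andP[_]; lra.
Qed.

(** The part of a section over the cell j, translated by - j / s along the first
coordinate, so that the pieces of all the cells lie over one interval. *)
Definition cell_piece m N X (s tau t : R) (j : int) : set 'rV[R]_m.+1 :=
  [set z | sect N X (s *: delta_mx 0 0) tau t (z + (j%:~R / s) *: delta_mx 0 0) /\
           cell s tau j (z + (j%:~R / s) *: delta_mx 0 0)].

(** By the assumption on N, the slices over the cell are balls of positive
radius even without the ridge; so their volumes are polynomial in j. *)
Lemma vol_cell_piece q N X (s tau t : R) j : 0 < s ->
  (forall xi, j%:~R <= xi < j%:~R + 1 ->
     t ^+ 2 + ((xi - tau) / s) ^+ 2 < N%:R ^+ 2) ->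
  forall c, (forall r, 0 < r -> vol (eball q.*2 r) = (c * r ^+ q)%:E) ->
  forall x, vol [set y : 'rV[R]_q.*2 | cell_piece N X s tau t j (vcons x y)] =
    if (0 <= s * x + tau < 1)%R then
      (c * ((N%:R ^+ 2 - t ^+ 2 - (x + j%:~R / s) ^+ 2) +
        (if X j then Num.min (s * x + tau) (1 - (s * x + tau)) ^+ 2 else 0)) ^+ q)%:E
    else 0%E.
Proof.
move=> s0 inside c cE x; have sn0 : s != 0 by rewrite gt_eqF.
pose z y : 'rV[R]_q.*2.+1 := vcons x y + (j%:~R / s) *: delta_mx 0 0.
have z0 y : z y 0 0 = x + j%:~R / s
  by rewrite /z [LHS]mxE vcons0 !mxE !eqxx mulr1.
have zz y : dot (z y) (z y) = (x + j%:~R / s) ^+ 2 + dot y y.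
  rewrite /z !(dotDl, dotDr, dotZl, dotZr) dot_vcons (dotC (delta_mx 0 0) (vcons _ _)).
  by rewrite !dot_delta vcons0 mxE !eqxx /=; ring.
have sz y : s * z y 0 0 + tau = s * x + tau + j%:~R.
  by rewrite z0 mulrDr mulrCA divff// mulr1; ring.
have cellE y : cell s tau j (z y) <-> (0 <= s * x + tau < 1).
  rewrite /cell /= sz; split=> /andP[h1 h2]; apply/andP; split; lra.
case: ifPn => [xc|xc]; last first.
  rewrite (_ : [set y | _] = set0); first exact: measure0.
  apply/seteqP; split => y // [_ /cellE h].
  by rewrite h in xc.
rewrite -cE.
  congr vol; apply/seteqP; split => y.
    move=> [+ _]; rewrite /sect /eball /= -/(z y) zz dotZr dot_delta sz.
    by rewrite ridge_cell//; move: (if X j then _ else _) => br h; lra.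
  rewrite /eball /= => yb; split; last exact/cellE.
  rewrite /sect /= -/(z y) zz dotZr dot_delta sz ridge_cell//.
  by move: yb; move: (if X j then _ else _) => br h; lra.
have := inside (s * x + tau + j%:~R); rewrite [_ - tau](_ : _ = s * (x + j%:~R / s)).
  rewrite mulrAC divff// mul1r => h.
  have {}h : t ^+ 2 + (x + j%:~R / s) ^+ 2 < N%:R ^+ 2.
    by apply: h; case/andP: xc => h1 h2; apply/andP; split; lra.
  case: ifP => _; last by lra.
  by have := sqr_ge0 (Num.min (s * x + tau) (1 - (s * x + tau))); lra.
by rewrite mulrDr mulrCA divff// mulr1; ring.
Qed.

Lemma borel_cell_piece m N X (s tau t : R) j : borel (@cell_piece m N X s tau t j).
Proof.
have h : borel (sect N X (s *: delta_mx 0 0 : 'rV[R]_m.+1) tau t `&` cell s tau j).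
  by apply: measurableI; [exact: borel_sect|exact: borel_cell].
have := borel_affine 1%:M ((j%:~R / s) *: delta_mx 0 0) h.
by under eq_set do rewrite mulmx1.
Qed.

Lemma vol_window_pieces m N X (s tau t : R) j k :
  vol (sect N X (s *: delta_mx 0 0) tau t `&` @window m s tau j k) =
  (\int[lambda]_x (\sum_(i < k)
     vol [set y : 'rV[R]_m | cell_piece N X s tau t (j + i%:Z) (vcons x y)]))%E.
Proof.
rewrite vol_window; last exact: borel_sect.
rewrite ge0_integral_sum//.
  apply: eq_bigr => i _; rewrite -vol_fubini; last exact: borel_cell_piece.
  rewrite -(vol_translate (((j + i%:Z)%:~R / s) *: delta_mx 0 0)) //.
  by apply: measurableI; [exact: borel_sect|exact: borel_cell].
by move=> i; apply: measurable_slice; exact: borel_cell_piece.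
Qed.

(** Over the window, slice by slice, the two volumes differ by the Thue-Morse
sum of the polynomial in the cell index that gives the contribution of one
ridge. *)
Lemma vol_sect_thue_morse_axis q N X X' (s tau t : R) j k : 0 < s -> (q.*2 < k)%N ->
  (forall i, (i < j) || (j + (2 ^ k)%:Z <= i) -> X i = X' i) ->
  (forall i : nat, (i < 2 ^ k)%N -> X (j + i%:Z) = nth false (thue_morse k) i) ->
  (forall i : nat, (i < 2 ^ k)%N -> X' (j + i%:Z) = ~~ nth false (thue_morse k) i) ->
  (forall xi, j%:~R <= xi < j%:~R + (2 ^ k)%:R ->
     t ^+ 2 + ((xi - tau) / s) ^+ 2 < N%:R ^+ 2) ->
  vol (sect N X (s *: delta_mx 0 0 : 'rV[R]_q.*2.+1) tau t) =
  vol (sect N X' (s *: delta_mx 0 0 : 'rV[R]_q.*2.+1) tau t).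
Proof.
move=> s0 qk Xout Xin X'in inside.
pose W := @window q.*2 s tau j (2 ^ k).
have mW : borel W by exact: borel_band.
rewrite (vol_split (borel_sect N X _ tau t) mW).
rewrite (vol_split (borel_sect N X' _ tau t) mW); congr (_ + _)%E.
  congr vol; apply/seteqP.
  suff h (z : 'rV[R]_q.*2.+1) : ~ W z ->
     ridge X (dot z (s *: delta_mx 0 0) + tau) = ridge X' (dot z (s *: delta_mx 0 0) + tau).
    by split => z [zS zW]; split => //; move: zS; rewrite /sect /= h.
  rewrite dotZr dot_delta => /negP; rewrite negb_and -ltNge -leNgt => zW.
  apply: ridge_eq; apply: Xout; case/orP: zW => h; apply/orP; [left|right].
    by rewrite -(ltr_int R); have /andP[h1 _] := floor_bounds (s * z 0 0 + tau); lra.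
  by rewrite floor_ge_int intrD -pmulrn.
rewrite !vol_window_pieces; apply: eq_integral => x _.
have [c cE] := vol_ball_even q.
have inside_i (i : 'I_(2 ^ k)) xi : (j + i%:Z)%:~R <= xi < (j + i%:Z)%:~R + 1 ->
     t ^+ 2 + ((xi - tau) / s) ^+ 2 < N%:R ^+ 2.
  rewrite intrD -pmulrn => /andP[h1 h2]; apply: inside.
  have : i.+1%:R <= (2 ^ k)%:R :> R by rewrite ler_nat.
  by have : 0 <= i%:R :> R by []; rewrite -natr1 => h3 h4; apply/andP; split; lra.
have pieceE Y (i : 'I_(2 ^ k)) := vol_cell_piece Y s0 (inside_i i) cE x.
under eq_bigr do rewrite pieceE//.
under [RHS]eq_bigr do rewrite pieceE//.
have [xc|xc] := boolP (0 <= s * x + tau < 1); last by rewrite !big1.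
rewrite sumEFin [RHS]sumEFin; congr EFin; rewrite -!mulr_sumr; congr (_ * _).
set beta := Num.min _ _ ^+ 2.
pose P : {poly R} := (N%:R ^+ 2 - t ^+ 2)%:P - (x%:P + s^-1 *: 'X) ^+ 2.
(* The gain from a ridge over the cell y, as a polynomial in y. *)
pose F : {poly R} := (P + beta%:P) ^+ q - P ^+ q.
have PE y : P.[y] = N%:R ^+ 2 - t ^+ 2 - (x + y / s) ^+ 2.
  by rewrite /P !hornerE [s^-1 * _]mulrC.
have FE y : F.[y] = (P.[y] + beta) ^+ q - P.[y] ^+ q.
  by rewrite /F !hornerE.
have sL : (size (x%:P + s^-1 *: 'X : {poly R})%R <= 2)%N.
  rewrite (leq_trans (size_polyD _ _))// geq_max.
  rewrite (leq_trans (size_polyC_leq1 _))// (leq_trans (size_scale_leq _ _))//.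
  by rewrite size_polyX.
have sexp (p : {poly R}) a b : (size p <= a.+1)%N -> (size (p ^+ b)%R <= (a * b).+1)%N.
  move=> sp; rewrite (leq_trans (size_poly_exp_leq _ _))// ltnS leq_mul2r.
  by apply/orP; right; case: (size p) sp.
have sP b : (size (P + b%:P)%R <= 3)%N.
  rewrite (leq_trans (size_polyD _ _))// geq_max (leq_trans (size_polyC_leq1 _))// andbT.
  rewrite (leq_trans (size_polyD _ _))// geq_max (leq_trans (size_polyC_leq1 _))//=.
  by rewrite size_polyN; exact: (sexp _ 1 2 sL).
have sF : (size F <= k)%N.
  apply: leq_trans qk; rewrite -mul2n.
  rewrite (leq_trans (size_polyD _ _))// geq_max size_polyN !sexp//.
  by have := sP 0; rewrite addr0.
have := prouhet (j%:~R) sF.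
have E Y (b : bool) :
  (forall i : nat, (i < 2 ^ k)%N ->
    Y (j + i%:Z) = (nth false (thue_morse k) i == b)) ->
  \sum_(i < 2 ^ k) (N%:R ^+ 2 - t ^+ 2 - (x + (j + i%:Z)%:~R / s) ^+ 2 +
      (if Y (j + i%:Z) then beta else 0)) ^+ q =
  \sum_(i < 2 ^ k) P.[j%:~R + i%:R] ^+ q +
  \sum_(i < 2 ^ k | nth false (thue_morse k) i == b) F.[j%:~R + i%:R].
  move=> Yb; rewrite [X in _ = _ + X]big_mkcond -big_split; apply: eq_bigr => i _.
  rewrite Yb// FE !PE intrD -pmulrn; case: ifP => _ /=; last by rewrite !addr0.
  by ring.
rewrite (E X true) ?(E X' false); last 2 first.
- by move=> i ik; rewrite X'in// eqbF_neg.
- by move=> i ik; rewrite Xin// eqb_id.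
under eq_bigl do rewrite -[nth _ _ _]eqb_id.
move=> ->; congr (_ + _); apply: eq_bigl => i; by rewrite eqbF_neg.
Qed.

End Cells.

(** * Congruent ridged balls *)

Section Congruence.
Variable R : realType.
Implicit Types (X : int -> bool) (n N : nat) (j : int).

(** An isometry that fixes 0 preserves scalar products, so it is determined by
the images of the basis vectors. *)
Lemma isometry_affine n (f : 'rV[R]_n -> 'rV[R]_n) :
  (forall x y, enorm (f x - f y) = enorm (x - y)) ->
  exists (Q : 'M[R]_n) (v : 'rV[R]_n), Q *m Q^T = 1%:M /\
    forall x, f x = x *m Q + v.
Proof.
move=> fN; pose g x := f x - f 0.
have dotf x y : dot (f x - f y) (f x - f y) = dot (x - y) (x - y).
  by rewrite -[LHS]sqr_sqrtr ?dot_ge0// -[RHS]sqr_sqrtr ?dot_ge0//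
    -!/(enorm _) fN.
have gg x : dot (g x) (g x) = dot x x by rewrite dotf subr0.
have gB x y : dot (g x) (g y) = dot x y.
  have : dot (g x - g y) (g x - g y) = dot (x - y) (x - y).
    by rewrite (_ : g x - g y = f x - f y) ?dotf// /g opprB addrA subrK.
  by rewrite (dotBB (g x)) (dotBB x) !gg; lra.
pose Q : 'M[R]_n := \matrix_i g (delta_mx 0 i).
have QE x i : (x *m Q^T) 0 i = dot x (g (delta_mx 0 i)).
  by rewrite dot_sum mxE; apply: eq_bigr => k _; rewrite !mxE.
have QQ : Q *m Q^T = 1%:M.
  apply/row_matrixP => i; rewrite row_mul rowK; apply/rowP => k.
  by rewrite QE gB dot_delta !mxE eqxx/= eq_sym.
have QQ' := mulmx1C QQ.
exists Q, (f 0); split => // x.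
have xE : x = g x *m Q^T.
  by apply/rowP => i; rewrite QE gB dot_delta.
by rewrite [in RHS]xE -mulmxA QQ' mulmx1 /g subrK.
Qed.

Lemma ridge_peak X (xi : R) : 4^-1 <= ridge X xi ->
  X (Num.floor xi) /\ xi = (Num.floor xi)%:~R + 2^-1.
Proof.
rewrite /ridge; have /andP[f1 f2] := floor_bounds xi.
case: ifPn => [Xj|_ h]; last by exfalso; lra.
move=> h; split => //.
by move: h; case: (leP (xi - (Num.floor xi)%:~R) _) => h1 h2; nra.
Qed.

Lemma ridge_mid X j : X j -> ridge X (j%:~R + 2^-1 : R) = 4^-1.
Proof.
move=> Xj; rewrite addrC ridge_cell ?Xj; last by apply/andP; split; lra.
rewrite (_ : 1 - 2^-1 = 2^-1 :> R) ?minxx; last by field.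
by rewrite exprVn; congr _^-1; ring.
Qed.

(** If 0, i and k are distinct, a^2 + b^2 = 1 and r is the distance from the axis
to the crest of the ridge over the cell j, these points run through a circle
in that crest. *)
Definition ridge_pt n (j : int) (r a b : R) (i k : 'I_n.+1) : 'rV[R]_n.+1 :=
  (j%:~R + 2^-1) *: delta_mx 0 0 + (r * a) *: delta_mx 0 i + (r * b) *: delta_mx 0 k.

Lemma dot_ridge_pt n j r a b (i k : 'I_n.+1) w :
  dot (ridge_pt j r a b i k) w = (j%:~R + 2^-1) * w 0 0 + r * (a * w 0 i + b * w 0 k).
Proof.
by rewrite /ridge_pt !(dotDl, dotZl) !(dotC _ w) !dot_delta; ring.
Qed.

(** The inscribed ball and the circumscribed cube force the isometry to fix the
origin. Then it maps crest points, those with |x|^2 = N^2 + 1/4, to crest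
points. So, if w is the direction that is mapped to the axis, dot x w is a
half-integer for every crest point x. A linear function that is not constant
on a circle of crest points also takes other values on it; hence w is the
axis direction up to sign. *)
Lemma congruent_bodies n N X1 X2 j0 : (1 < n)%N -> (0 < N)%N ->
  (- N%:Z <= j0 < N%:Z)%R -> X1 j0 ->
  congruent (@body R n N X1) (body N X2) ->
  (forall j, (- N%:Z <= j < N%:Z)%R -> X1 j -> X2 j) \/
  (forall j, (- N%:Z <= j < N%:Z)%R -> X1 j -> X2 (- j - 1)).
Proof.
move=> n1 N0 j0N Xj0 [f [/isometry_affine[Q [v [QQ fE]]] f12]].
have QQ' := mulmx1C QQ.
have fB x : body N X1 x -> body N X2 (x *m Q + v).
  by move=> xB; rewrite -f12; exists x.
have bodyQ (x : 'rV[R]_n.+1) : dot x x <= N%:R ^+ 2 -> body N X2 (x + v).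
  move=> xN; have -> : x = (x *m Q^T) *m Q by rewrite -mulmxA QQ' mulmx1.
  apply: fB; apply: ball_body; rewrite /eball /= dotM trmxK.
  by rewrite -mulmxA QQ' mulmx1.
(* Both v + N e_i and v - N e_i lie in the cube. *)
have v0 : v = 0.
  apply/rowP => i; rewrite [RHS]mxE.
  have h (s : R) : s ^+ 2 = 1 -> `|s * N%:R + v 0 i| <= N%:R.
    move=> s1; have := @bodyQ ((s * N%:R) *: delta_mx 0 i).
    rewrite dotZl dotZr dot_delta mxE !eqxx mulr1 -expr2 exprMn s1 mul1r.
    move=> /(_ (lexx _)) /(body_cube i N0).
    by rewrite !mxE !eqxx mulr1.
  have := h 1; have := h (-1); rewrite sqrrN expr1n => /(_ erefl) + /(_ erefl).
  rewrite mul1r mulN1r !ler_norml => /andP[h1 h2] /andP[h3 h4].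
  by lra.
pose w : 'rV[R]_n.+1 := delta_mx 0 0 *m Q^T.
have ww : dot w w = 1.
  by rewrite /w dotM trmxK -mulmxA QQ' mulmx1 dot_delta mxE !eqxx.
have peak (x : 'rV[R]_n.+1) j : X1 j -> x 0 0 = j%:~R + 2^-1 ->
    dot x x = N%:R ^+ 2 + 4^-1 ->
    X2 (Num.floor (dot x w)) /\ dot x w = (Num.floor (dot x w))%:~R + 2^-1.
  move=> Xj x0 xx; apply: ridge_peak.
  have : body N X1 x by rewrite /body /= x0 ridge_mid// xx.
  move=> /fB; rewrite v0 addr0 /body /= dotM -mulmxA QQ mulmx1 xx lerD2l.
  by rewrite -dot_delta dotM.
have radius j : (- N%:Z <= j < N%:Z)%R ->
    exists2 r : R, 0 < r & r ^+ 2 = N%:R ^+ 2 + 4^-1 - (j%:~R + 2^-1) ^+ 2.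
  move=> /andP[jN1 jN2].
  have h1 : - N%:R <= j%:~R :> R by rewrite -[N%:R]/(N%:Z%:~R) -mulrNz ler_int.
  have h2 : j%:~R <= N%:R - 1 :> R.
    rewrite -[N%:R]/(N%:Z%:~R) -[1]/(1%:Z%:~R) -intrB ler_int; lia.
  have h3 : 1 <= N%:R :> R by rewrite ler1n.
  have h : 0 < N%:R ^+ 2 + 4^-1 - (j%:~R + 2^-1) ^+ 2 :> R by nra.
  exists (Num.sqrt (N%:R ^+ 2 + 4^-1 - (j%:~R + 2^-1) ^+ 2)).
    by rewrite sqrtr_gt0.
  by rewrite sqr_sqrtr// ltW.
have peak_pt j r a b (i k : 'I_n.+1) : X1 j ->
    r ^+ 2 = N%:R ^+ 2 + 4^-1 - (j%:~R + 2^-1) ^+ 2 -> a ^+ 2 + b ^+ 2 = 1 ->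
    i != 0 -> k != 0 -> i != k ->
    let s := (j%:~R + 2^-1) * w 0 0 + r * (a * w 0 i + b * w 0 k) in
    X2 (Num.floor s) /\ s = (Num.floor s)%:~R + 2^-1.
  move=> Xj rE ab i0 k0 ik; have := peak (ridge_pt j r a b i k) j Xj.
  rewrite (dot_ridge_pt _ _ _ _ _ _ w).
  have ptE l : ridge_pt j r a b i k 0 l =
      (j%:~R + 2^-1) * (l == 0)%:R + r * a * (l == i)%:R + r * b * (l == k)%:R.
    by rewrite !mxE.
  apply.
    by rewrite ptE eqxx (eq_sym 0 i) (eq_sym 0 k) (negPf i0) (negPf k0) /=; ring.
  rewrite dot_ridge_pt !ptE !eqxx (eq_sym 0 i) (eq_sym 0 k) (negPf i0) (negPf k0).
  rewrite (eq_sym k i) (negPf ik) /=.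
  transitivity ((j%:~R + 2^-1) ^+ 2 + r ^+ 2 * (a ^+ 2 + b ^+ 2)); first by ring.
  by rewrite rE ab; ring.
have w0 i : i != 0 -> w 0 i = 0.
  move=> i0; apply/eqP/negP => /negP wi.
  have [k /andP[k0 ik]] : exists k : 'I_n.+1, (k != 0) && (i != k).
    have [i1|i1] := eqVneq (val i) 1%N.
      by exists (inord 2); rewrite -!val_eqE /= inordK// i1.
    by exists (inord 1); rewrite -!val_eqE /= inordK ?i1// ltnW.
  have [r r0 rE] := radius _ j0N.
  set h := Num.sqrt (w 0 i ^+ 2 + w 0 k ^+ 2).
  have h0 : 0 < w 0 i ^+ 2 + w 0 k ^+ 2.
    by rewrite ltr_pwDl ?sqr_ge0// exprn_even_gt0.
  have hh : h ^+ 2 = w 0 i ^+ 2 + w 0 k ^+ 2 by rewrite sqr_sqrtr// ltW.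
  have h1 : 0 < h by rewrite sqrtr_gt0.
  (* On the circle, dot x w takes all values between its mean and its mean plus r h. *)
  have val mu : 0 <= mu <= 1 ->
      let s := (j0%:~R + 2^-1) * w 0 0 + r * h * mu in
      s = (Num.floor s)%:~R + 2^-1.
    move=> /andP[mu0 mu1].
    have m1 : 0 <= 1 - mu ^+ 2 by nra.
    set nu := Num.sqrt (1 - mu ^+ 2).
    have nuE : nu ^+ 2 = 1 - mu ^+ 2 by rewrite sqr_sqrtr.
    have := @peak_pt j0 r ((mu * w 0 i - nu * w 0 k) / h)
      ((mu * w 0 k + nu * w 0 i) / h) i k Xj0 rE.
    rewrite [r * (_ + _)](_ : _ = r * h * mu); last first.
      by rewrite -[h in RHS](mulfK (lt0r_neq0 h1)) -expr2 hh; field; exact: lt0r_neq0.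
    move=> /(_ _ i0 k0 ik)[]//.
    transitivity ((mu ^+ 2 + nu ^+ 2) * (w 0 i ^+ 2 + w 0 k ^+ 2) / h ^+ 2).
      by field; exact: lt0r_neq0.
    by rewrite nuE -hh mulfK ?expf_neq0 ?lt0r_neq0//; ring.
  have := val 0; rewrite mulr0 addr0 lexx ler01 => /(_ isT) /=.
  set al := (j0%:~R + 2^-1) * w 0 0 in val *; move=> alE.
  (* A rise by at most 1/4 does not lead from a half-integer to another one. *)
  pose mu := Num.min 1 (4^-1 / (r * h)).
  have rh0 : 0 < r * h by rewrite mulr_gt0.
  have mu0 : 0 < mu by rewrite lt_min ltr01 divr_gt0.
  have := val mu; rewrite ltW//= ge_min lexx => /(_ isT).
  have b1 : r * h * mu <= 4^-1.
    by rewrite mulrC -ler_pdivlMr// ge_min lexx orbT.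
  have b2 : 0 < r * h * mu by rewrite mulr_gt0.
  move: (Num.floor al) (Num.floor (al + _)) alE => m1 m2 e1 e2.
  have : m1%:~R < m2%:~R :> R by lra.
  have : m2%:~R < (m1 + 1)%:~R :> R by rewrite intrD; lra.
  by rewrite !ltr_int ltzD1 leNgt => /negP.
have w00 : w 0 0 ^+ 2 = 1.
  move: ww; rewrite dot_sum (bigD1 0)//= big1 ?addr0 -?expr2// => i i0.
  by rewrite w0// mulr0.
have [i [k [i0 k0 ik]]] : exists i k : 'I_n.+1, [/\ i != 0, k != 0 & i != k].
  by exists (inord 1), (inord 2); rewrite -!val_eqE /= !inordK// ltnW.
have fin j : (- N%:Z <= j < N%:Z)%R -> X1 j ->
    X2 (Num.floor ((j%:~R + 2^-1) * w 0 0)).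
  move=> jN Xj; have [r r0 rE] := radius _ jN.
  have := @peak_pt j r 1 0 i k Xj rE; rewrite expr1n expr0n/= addr0.
  by move=> /(_ erefl i0 k0 ik)[+ _]; rewrite /= (w0 _ i0) (w0 _ k0) !(mulr0, addr0).
have /orP[/eqP e|/eqP e] : (w 0 0 == 1) || (w 0 0 == -1) by rewrite -sqrf_eq1 w00.
  left => j jN Xj; have := fin j jN Xj; rewrite e mulr1.
  by rewrite (@floor_def _ _ j)// intrD; lra.
right => j jN Xj; have := fin j jN Xj; rewrite e mulrN1.
by rewrite (@floor_def _ _ (- j - 1))// subrK intrB !mulrNz; lra.
Qed.

End Congruence.

(** * The two bodies *)

Section Rotation.
Variable R : realType.
Implicit Types (X : int -> bool) (n m N : nat) (j : int).

Lemma vol_sect_rotate m N X (b : 'rV[R]_m.+1) tau t (s : R) : 0 < s ->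
  dot b b = s ^+ 2 ->
  vol (sect N X b tau t) = vol (sect N X (s *: delta_mx 0 0 : 'rV[R]_m.+1) tau t).
Proof.
move=> s0 bs; pose v := s^-1 *: b; have sn0 : s != 0 by rewrite gt_eqF.
have sv : sphere v.
  rewrite /sphere /= /enorm /v dotZl dotZr bs.
  by rewrite (_ : _ * _ = 1) ?sqrtr1//; field.
have Bv := perp_frameP sv.
pose P : 'M[R]_m.+1 := (col_mx v (perp_frame v) : 'M[R]_(1 + m, m.+1)).
have PP : P *m P^T = 1%:M := frame_orthogonal sv Bv.
rewrite -(vol_orthogonal PP); last exact: borel_sect.
have bP : b *m P^T = s *: delta_mx 0 0.
  have -> : b = s *: (delta_mx 0 0 *m P).
    have -> : delta_mx 0 0 *m P = v.
      have E0 : @lshift 1 m 0 = (0 : 'I_m.+1) by exact: val_inj.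
      have := rowKu 0 v (perp_frame v); rewrite E0 row_id => e.
      by rewrite -rowE -[RHS]e.
    by rewrite /v scalerA divff// scale1r.
  by rewrite -scalemxAl -mulmxA PP mulmx1.
congr vol; apply: eq_set => z; rewrite /sect /= !dotM bP.
by rewrite -mulmxA PP mulmx1.
Qed.

Lemma vol_sect_thue_morse q N X X' (b : 'rV[R]_q.*2.+1) (s tau t : R) j k :
  0 < s -> dot b b = s ^+ 2 -> (q.*2 < k)%N ->
  (forall i, (i < j) || (j + (2 ^ k)%:Z <= i) -> X i = X' i) ->
  (forall i : nat, (i < 2 ^ k)%N -> X (j + i%:Z) = nth false (thue_morse k) i) ->
  (forall i : nat, (i < 2 ^ k)%N -> X' (j + i%:Z) = ~~ nth false (thue_morse k) i) ->
  (forall xi, j%:~R <= xi < j%:~R + (2 ^ k)%:R ->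
     t ^+ 2 + ((xi - tau) / s) ^+ 2 < N%:R ^+ 2) ->
  vol (sect N X b tau t) = vol (sect N X' b tau t).
Proof.
move=> s0 bs qk Xo Xi Xi' ins; rewrite !(vol_sect_rotate _ _ _ _ s0 bs).
exact: vol_sect_thue_morse_axis qk Xo Xi Xi' ins.
Qed.

End Rotation.

Section Pattern.
Variables (q : nat).
Let k := q.*2.+1.
Let W : nat := (2 ^ q.*2)%N.
Let W2 : (2 ^ k = W + W)%N. Proof. by rewrite /k expnS mul2n addnn. Qed.
Let W0 : (0 < W)%N. Proof. by rewrite expn_gt0. Qed.

Definition middle (j : int) : bool :=
  (- W%:Z <= j < W%:Z) && nth false (thue_morse k) (absz (j + W%:Z)).

(** Hyperplanes near the origin with |b| <= 1/2 do not reach the latitude 3 W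
inside the body, and those with |b| > 1/2 pass the latitudes in [- W, W) inside
the ball of radius 4 W. *)
Definition outer : int := (3 * W)%N%:Z.

Definition pattern (e : bool) (j : int) : bool :=
  middle j || (j == if e then outer else - outer - 1).

Definition radius : nat := (4 * W)%N.

Lemma middle_out j : (j < - W%:Z) || (W%:Z <= j) -> middle j = false.
Proof. by rewrite /middle; lia. Qed.

Lemma middle_in (i : nat) : (i < 2 ^ k)%N -> middle (- W%:Z + i%:Z) = nth false (thue_morse k) i.
Proof.
rewrite /middle W2 => iW; rewrite (_ : absz _ = i); last by lia.
by rewrite (_ : _ && _ = nth false (thue_morse k) i)//; lia.
Qed.

Lemma middle_mirror (i : nat) : (i < 2 ^ k)%N ->
  middle (- (- W%:Z + i%:Z) - 1) = ~~ nth false (thue_morse k) i.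
Proof.
move=> ik; rewrite -nth_thue_morse_rev//; last by rewrite /k /= odd_double.
rewrite -middle_in; last by lia.
by congr middle; rewrite W2 in ik *; lia.
Qed.

Lemma pattern_flipped e : flipped outer (pattern e) (pattern (~~ e)).
Proof.
have mo : middle outer = false by apply: middle_out; rewrite /outer; lia.
have mo' : middle (- outer - 1) = false by apply: middle_out; rewrite /outer; lia.
split => [j j1 j2||]; rewrite /pattern ?mo ?mo' /=.
- by case: e; rewrite (negPf j1) (negPf j2).
- by case: e; rewrite /= ?eqxx//; lia.
- by case: e; rewrite /= ?eqxx//; lia.
Qed.

Lemma pattern_out e i : (i < - W%:Z) || (- W%:Z + (2 ^ k)%:Z <= i) ->
  pattern e i = mirror (pattern (~~ e)) i.
Proof.
rewrite W2 /mirror /pattern => h; rewrite !middle_out /=; try by lia.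
by case: e; rewrite /=; lia.
Qed.

Lemma pattern_in e (i : nat) : (i < 2 ^ k)%N ->
  pattern e (- W%:Z + i%:Z) = nth false (thue_morse k) i.
Proof.
move=> ik; rewrite /pattern middle_in//; rewrite W2 in ik.
rewrite (_ : (_ == _) = false) ?orbF//.
by case: e; rewrite /outer; lia.
Qed.

Lemma pattern_mirror_in e (i : nat) : (i < 2 ^ k)%N ->
  mirror (pattern e) (- W%:Z + i%:Z) = ~~ nth false (thue_morse k) i.
Proof.
move=> ik; rewrite /mirror /pattern middle_mirror//; rewrite W2 in ik.
rewrite (_ : (_ == _) = false) ?orbF//.
by case: e; rewrite /outer; lia.
Qed.

Variable R : realType.
Local Notation n := (q.*2.+1).

(** The middle cells of [pattern e] can be replaced by their complement, and
this gives the mirror image of [pattern (~~ e)]. *)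
Lemma vol_steep_section e (b : 'rV[R]_n) (c t : R) :
  4^-1 < dot b b -> c ^+ 2 <= 1 -> t ^+ 2 < 4^-1 ->
  vol (sect radius (pattern e) b (t * c) t) =
  vol (sect radius (pattern (~~ e)) b (- t * c) (- t)).
Proof.
move=> bb c1 t2.
have bb0 : 0 <= dot b b := dot_ge0 b.
have s2 : Num.sqrt (dot b b) ^+ 2 = dot b b by rewrite sqr_sqrtr.
have s0 : 0 < Num.sqrt (dot b b) by rewrite sqrtr_gt0; lra.
rewrite [RHS]vol_sect_mirror mulNr !opprK.
apply: (vol_sect_thue_morse (j := - W%:Z) (k := k) s0 (esym s2)) => //.
- by move=> i; exact: pattern_out.
- by move=> i; exact: pattern_in.
- by move=> i ik; exact: pattern_mirror_in.
move: (Num.sqrt (dot b b)) s2 s0 => s s2 s0 xi.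
rewrite mulrNz -pmulrn W2 natrD => /andP[x1 x2].
have W1 : 1 <= W%:R :> R by rewrite ler1n.
have rE : radius%:R = 4 * W%:R :> R by rewrite natrM.
have tc : (t * c) ^+ 2 <= 4^-1.
  by rewrite exprMn (le_trans _ (ltW t2))// ler_piMr ?sqr_ge0.
have tc1 : - 2^-1 <= t * c <= 2^-1 by apply/andP; split; nra.
have h : ((xi - t * c) / s) ^+ 2 <= 4 * (W%:R + 2^-1) ^+ 2.
  rewrite exprMn exprVn ler_pdivrMr ?exprn_gt0// s2.
  have : (xi - t * c) ^+ 2 <= (W%:R + 2^-1) ^+ 2.
    rewrite -[leRHS]real_normK ?num_real// -[leLHS]real_normK ?num_real//.
    rewrite ler_pXn2r ?nnegrE// [leRHS]ger0_norm; last lra.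
    by rewrite ler_norml; case/andP: tc1 => h1 h2; apply/andP; split; lra.
  have : 0 <= (W%:R + 2^-1) ^+ 2 :> R by rewrite sqr_ge0.
  by move: ((W%:R + 2^-1) ^+ 2) ((xi - t * c) ^+ 2) => y1 y2 h1 h2; nra.
by rewrite rE; nra.
Qed.

(** The points of the hyperplane at the latitudes of the outer ridges are
outside both bodies. *)
Lemma flat_section e (b : 'rV[R]_n) (c t : R) :
  dot b b <= 4^-1 -> c ^+ 2 <= 1 -> t ^+ 2 < 4^-1 ->
  sect radius (pattern e) b (t * c) t = sect radius (pattern (~~ e)) b (t * c) t.
Proof.
move=> bb c1 t2.
have W1 : 1 <= W%:R :> R by rewrite ler1n.
have rE : radius%:R = 4 * W%:R :> R by rewrite natrM.
have oE : outer%:~R = 3 * W%:R :> R by rewrite -pmulrn natrM.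
have o0 : 0 <= outer by [].
have tc : (t * c) ^+ 2 <= 4^-1.
  by rewrite exprMn (le_trans _ (ltW t2))// ler_piMr ?sqr_ge0.
have tc1 : - 2^-1 <= t * c <= 2^-1 by apply/andP; split; nra.
have far z : in_slab outer (dot z b + t * c) -> radius%:R ^+ 2 + 4^-1 < dot z z + t ^+ 2.
  rewrite /in_slab oE => /andP[h _].
  have zb : 4 * dot z b ^+ 2 <= dot z z.
    (* The Cauchy-Schwarz inequality, with the bound 1/4 in place of dot b b. *)
    have := dot_ge0 (z - (4 * dot z b) *: b).
    rewrite dotBB dotZr dotZl dotZr.
    have := sqr_ge0 (dot z b); nra.
  have : (3 * W%:R - 2^-1) ^+ 2 <= dot z b ^+ 2.
    rewrite -[leRHS]real_normK ?num_real// ler_pXn2r ?nnegrE//; last by lra.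
    have := ler_normD (dot z b) (t * c).
    have : `|t * c| <= 2^-1 by rewrite ler_norml.
    lra.
  by rewrite rE; nra.
apply/seteqP; split => z; rewrite /sect /=;
  have [/far zs|zs] := pselect (in_slab outer (dot z b + t * c)).
- by have := ridge_le4 (pattern e) (dot z b + t * c); lra.
- by rewrite (ridge_out o0 (pattern_flipped e)).
- by have := ridge_le4 (pattern (~~ e)) (dot z b + t * c); lra.
- by rewrite (ridge_out o0 (pattern_flipped e)).
Qed.

(** A ridge raises the squared radius by at most 1/4, so at distance 1/2 or more
the section lies in a ball of radius N around its centre, and the central
section contains such a ball. *)
Lemma section_le e (b : 'rV[R]_n) (c t : R) : c ^+ 2 <= 1 ->
  exists t', (vol (sect radius (pattern e) b (t * c) t) <=
              vol (sect radius (pattern (~~ e)) b (t' * c) t'))%E.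
Proof.
move=> c1; have [t2|t2] := leP 4^-1 (t ^+ 2).
  exists 0; rewrite mul0r; apply: vol_le; [exact: borel_sect|exact: borel_sect|].
  move=> z zS; apply: sphere_sect; move: zS; rewrite /sect /=.
  have := ridge_le4 (pattern e) (dot z b + t * c); lra.
have [bb|bb] := leP (dot b b) 4^-1.
  by exists t; rewrite flat_section.
by exists (- t); rewrite vol_steep_section.
Qed.

Lemma maximal_section_le e (u : 'rV[R]_n.+1) : sphere u ->
  (maximal_section (body radius (pattern e)) u <=
   maximal_section (body radius (pattern (~~ e))) u)%E.
Proof.
move=> su; rewrite /maximal_section; apply: ge_ereal_sup => _ [t _ <-].
rewrite section_vol//.
have u1 : u 0 0 ^+ 2 <= 1 by rewrite -(dot_uu su) coord_dot.
have [t' /le_trans] := section_le e (axis_of u) t u1; apply.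
by apply: ereal_sup_ubound; exists t' => //; rewrite section_vol.
Qed.

End Pattern.

Theorem theorem2 (R : realType) (d : nat) (d_ge4 : (4 <= d)%N)
    (d_even : ~~ odd d) :
  exists K1 K2 : set 'rV[R]_d,
    [/\ convex_body K1, K1 0 & body_of_revolution K1] /\
    [/\ convex_body K2, K2 0 & body_of_revolution K2] /\
    ~ congruent K1 K2 /\
    forall u : 'rV[R]_d, sphere u ->
      [/\ central_section K1 u = central_section K2 u,
          maximal_section K1 u = maximal_section K2 u &
          projection_vol K1 u = projection_vol K2 u].
Proof.
have [q dE q1] : exists2 q, d = q.*2.+2 & (0 < q)%N.
  exists d./2.-1; last by lia.
  by have := odd_double_half d; rewrite (negPf d_even); lia.
rewrite {}dE {d_ge4 d_even}.
pose N := radius q.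
have N0 : (0 < N)%N by rewrite muln_gt0 expn_gt0.
pose K e : set 'rV[R]_q.*2.+2 := body N (pattern q e).
have K0 e : K e 0 by apply: ball_body; rewrite /eball /= dot0l sqr_ge0.
have o0 : 0 <= outer q by [].
have fl : flipped (outer q) (pattern q true) (pattern q false) := pattern_flipped q true.
exists (K true), (K false).
split; first by split => //; [exact: convex_body_body|exact: revolution_body].
split; first by split => //; [exact: convex_body_body|exact: revolution_body].
split.
  have W0 : (0 < 2 ^ q.*2)%N by rewrite expn_gt0.
  have mo : middle q (outer q) = false by apply: middle_out; rewrite /outer; lia.
  have o1 : (- N%:Z <= outer q < N%:Z)%R by rewrite /outer /N /radius; lia.
  have Xo : pattern q true (outer q) by rewrite /pattern eqxx orbT.
  move=> /(congruent_bodies _ N0 o1 Xo) [|h|h]; first by lia.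
    by have := h _ o1 Xo; rewrite /pattern mo /=; rewrite /outer; lia.
  have k0 : (0 < 2 ^ q.*2.+1)%N by rewrite expn_gt0.
  (* The cell - W is a middle cell, so by antisymmetry its mirror image is not. *)
  have := h (- (2 ^ q.*2)%N%:Z + 0%N%:Z).
  rewrite pattern_in// nth_thue_morse0 [pattern _ _ _](pattern_mirror_in false k0) nth_thue_morse0.
  by move=> /(_ _ isT) h'; apply: notF; apply: h'; rewrite /N /radius; lia.
move=> u su; have u1 : u 0 0 ^+ 2 <= 1 by rewrite -(dot_uu su) coord_dot.
split.
- rewrite (central_vol _ _ su) [RHS](central_vol _ _ su).
  exact: (@vol_central_flip R (outer q) (pattern q true) (pattern q false) o0 fl).
- have h1 := maximal_section_le true su; have h2 := maximal_section_le false su.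
  by apply/le_anti/andP; split; [exact: h1|exact: h2].
- rewrite (projection_volE _ _ su) [RHS](projection_volE _ _ su).
  by apply: (vol_shadow_flip o0 fl u1); exact: borel_shadow.
Qed.
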